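(* For $i,j,k\in\{0,1,\dots,2\ell\}$ define $$\begin{aligned}\gamma(\nu;i,j,k)={}&(-1)^k(\nu+2\ell)(\nu+2\ell-k)\binom{2\ell}{k}\binom{k}{\frac12(k+i-j)}\binom{2\ell-k}{\frac12(i+j-k)}\\&\times\frac{\Gamma(\nu-\frac12(k-i-j))\,\Gamma(\nu+2\ell-\frac12(k+i+j))}{\Gamma(\nu)\,\Gamma(\nu+2\ell+1-\frac12(k-i+j))\,\Gamma(\nu+2\ell+1-\frac12(k+i-j))}\end{aligned}$$ if $i+j\equiv k\pmod 2$, and $\gamma(\nu;i,j,k)=0$ otherwise. Let the matrix $F^{(\nu)}_{k,n}$ be given by $$(F^{(\nu)}_{k,n})_{i,j}=\frac{n!\,\Gamma(\nu+2\ell)}{2^n}\,\gamma(\nu+n;i,j,k),\qquad i,j\in\{0,1,\dots,2\ell\}.$$ Then for every $n\in\mathbb N$ $$\hat P_n^{(\nu)}(x)=\sum_{k=0}^{\min(n,2\ell)}F^{(\nu)}_{k,n}\,C^{(\nu+2\ell)}_{n-k}(x).$$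
   Context: $\mathbb N=\{0,1,2,\dots\}$; $\ell\in\frac12\mathbb N$ and real $\nu>0$ are fixed. $(a)_k=a(a+1)\cdots(a+k-1)$ is the Pochhammer symbol. The scalar Gegenbauer polynomials are $C_n^{(\nu)}(x)=\sum_{k=0}^{\lfloor n/2\rfloor}(-1)^k\frac{\Gamma(\nu+n-k)}{k!\,(n-2k)!\,\Gamma(\nu)}(2x)^{n-2k}$. All matrices have size $(2\ell+1)\times(2\ell+1)$, with rows and columns indexed by $0,1,\dots,2\ell$; $\mathbf 1$ is the identity matrix. Matrix weight: for $x\in(-1,1)$, $W^{(\nu)}(x)$ is the (symmetric, positive definite) matrix with entries $$(W^{(\nu)}(x))_{i,j}=(1-x^2)^{\nu-\frac12}\sum_{k=\max(0,i+j-2\ell)}^{\min(i,j)}\alpha_k(i,j)\,C^{(\nu)}_{i+j-2k}(x),$$ $$\alpha_k(i,j)=(-1)^k\frac{i!\,j!\,(i+j-2k)!}{k!\,(2\nu)_{i+j-2k}(\nu)_{i+j-k}}\,\frac{(\nu)_{i-k}(\nu)_{j-k}}{(i-k)!\,(j-k)!}\,\frac{i+j-2k+\nu}{i+j-k+\nu}\,\frac{(2\ell-i)!\,(2\ell-j)!}{(2\ell+k-i-j)!}\,(-2\ell-\nu)_k\,\frac{2\ell+\nu}{(2\ell)!}.$$ The monic matrix-valued Gegenbauer polynomials $P_n^{(\nu)}(x)=x^n\mathbf 1+(\text{lower order terms with matrix coefficients})$, $n\in\mathbb N$, are the unique monic matrix polynomials with $\int_{-1}^1P_n^{(\nu)}(x)W^{(\nu)}(x)P_m^{(\nu)}(x)^{*}\,dx=0$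 for $n\neq m$. Put $\hat P_n^{(\nu)}(x)=D_n^{(\nu)}P_n^{(\nu)}(x)$, where $D_n^{(\nu)}$ is the diagonal matrix with $(D_n^{(\nu)})_{i,i}=\binom{2\ell}{i}\frac{(\nu+n)_i}{(\nu+n+2\ell-i)_i}$. Convention: a binomial coefficient $\binom ab$ with $a\in\mathbb N$, $b\in\mathbb Z$ is zero unless $0\le b\le a$, and $\gamma$ is understood to be zero whenever one of its binomial factors vanishes. *)

(* Defs.v *)
From HB Require Import structures.
From mathcomp Require Import all_boot all_order all_algebra.
From mathcomp Require Import complex.
From mathcomp Require Import all_classical all_reals all_analysis.
Set Implicit Arguments.
Unset Strict Implicit.
Unset Printing Implicit Defensive.
Import Order.TTheory GRing.Theory Num.Theory.
Local Open Scope classical_set_scope.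
Local Open Scope ring_scope.

(* Throughout, N : nat stands for 2l (l a half-integer), and matrices of size
   (2l+1) x (2l+1) have type 'M_N.+1, with indices 0, ..., N. *)

(* Euler's integral; only its values at a > 0 are meaningful. *)
Definition Gamma (R : realType) (a : R) : R :=
  Rintegral (@lebesgue_measure R) `]0, +oo[
    (fun t : R => t `^ (a - 1) * expR (- t)).

Definition pochhammer (R : realType) (a : R) (k : nat) : R :=
  \prod_(m < k) (a + m%:R).

Definition gegenbauer (R : realType) (nu : R) (n : nat) : {poly R} :=
  \sum_(k < n./2.+1)
    ((-1) ^+ k * (Gamma (nu + (n - k)%:R)
                  / (k`!%:R * (n - k.*2)`!%:R * Gamma nu)))
    *: (2 *: 'X) ^+ (n - k.*2).

(* alpha_k(i,j); the truncated subtractions are exact for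
   max(0, i+j-N) <= k <= min(i,j) and i, j <= N. *)
Definition alpha (R : realType) (N : nat) (nu : R) (k i j : nat) : R :=
  (-1) ^+ k
  * ((i`!%:R * j`!%:R * (i + j - k.*2)`!%:R)
     / (k`!%:R * pochhammer (2 * nu) (i + j - k.*2)
        * pochhammer nu (i + j - k)))
  * ((pochhammer nu (i - k) * pochhammer nu (j - k))
     / ((i - k)`!%:R * (j - k)`!%:R))
  * (((i + j - k.*2)%:R + nu) / ((i + j - k)%:R + nu))
  * (((N - i)`!%:R * (N - j)`!%:R) / (N + k - (i + j))`!%:R)
  * pochhammer (- N%:R - nu) k
  * ((N%:R + nu) / N`!%:R).

(* The lower summation bound is max(0, i+j-N), by truncated subtraction. *)
Definition gegenbauer_weight (R : realType) (N : nat) (nu x : R)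
    : 'M[R]_N.+1 :=
  \matrix_(i, j)
    ((1 - x ^+ 2) `^ (nu - 2^-1)
     * \sum_(i + j - N <= k < (minn i j).+1)
         alpha N nu k i j * (gegenbauer nu (i + j - k.*2)).[x]).

Definition Cintegral (R : realType) (D : set R) (f : R -> R[i]) : R[i] :=
  Complex (Rintegral (@lebesgue_measure R) D (fun x => complex.Re (f x)))
          (Rintegral (@lebesgue_measure R) D (fun x => complex.Im (f x))).

Definition mx_integral (R : realType) (N : nat) (D : set R)
    (F : R -> 'M[R[i]]_N.+1) : 'M[R[i]]_N.+1 :=
  \matrix_(i, j) Cintegral D (fun x => F x i j).

Definition adjmx (R : realType) (N : nat) (A : 'M[R[i]]_N.+1)
    : 'M[R[i]]_N.+1 :=
  (map_mx (fun z : R[i] => z^*) A)^T.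

(* Value at a scalar z; scalar matrices are central, so the side on which the
   coefficients are written is immaterial. *)
Definition mxpoly_eval (R : realType) (N : nat) (P : {poly 'M[R[i]]_N.+1})
    (z : R[i]) : 'M[R[i]]_N.+1 :=
  P.[z%:M].

Definition gegenbauer_pairing (R : realType) (N : nat) (nu : R)
    (P Q : {poly 'M[R[i]]_N.+1}) : 'M[R[i]]_N.+1 :=
  mx_integral `]-1, 1[
    (fun x : R =>
       mxpoly_eval P (real_complex R x)
       *m map_mx (real_complex R) (gegenbauer_weight N nu x)
       *m adjmx (mxpoly_eval Q (real_complex R x))).

Definition monic_mx_gegenbauer (R : realType) (N : nat) (nu : R)
    (P : nat -> {poly 'M[R[i]]_N.+1}) : Prop :=
  (forall n : nat, P n \is monic /\ size (P n) = n.+1) /\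
  (forall n m : nat, n <> m -> gegenbauer_pairing nu (P n) (P m) = 0).

Definition Dmx (R : realType) (N : nat) (nu : R) (n : nat) : 'M[R]_N.+1 :=
  diag_mx (\row_(i < N.+1)
    ('C(N, i)%:R * (pochhammer (nu + n%:R) i
                    / pochhammer (nu + n%:R + (N - i)%:R) i))).

Definition hat_mx_gegenbauer (R : realType) (N : nat) (nu : R)
    (P : nat -> {poly 'M[R[i]]_N.+1}) (n : nat) (z : R[i])
    : 'M[R[i]]_N.+1 :=
  map_mx (real_complex R) (Dmx N nu n) *m mxpoly_eval (P n) z.

(* Binomial coefficient with an integer lower argument, 0 unless 0 <= b <= a. *)
Definition binz (a : nat) (b : int) : nat :=
  if b is Posz m then 'C(a, m) else 0%N.

(* Integer halves are exact when i + j = k mod 2.  When a binomial factor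
   vanishes, so does the product, whatever the (total) Gamma yields; when none
   does, every Gamma is evaluated at a positive argument. *)
Definition gamma_coef (R : realType) (N : nat) (nu : R) (i j k : nat) : R :=
  if odd (i + j) == odd k then
    (-1) ^+ k * (nu + N%:R) * (nu + N%:R - k%:R)
    * 'C(N, k)%:R
    * (binz k ((k%:Z + i%:Z - j%:Z) %/ 2)%Z)%:R
    * (binz (N - k) ((i%:Z + j%:Z - k%:Z) %/ 2)%Z)%:R
    * ((Gamma (nu - (k%:R - i%:R - j%:R) / 2)
        * Gamma (nu + N%:R - (k%:R + i%:R + j%:R) / 2))
       / (Gamma nu
          * Gamma (nu + N%:R + 1 - (k%:R - i%:R + j%:R) / 2)
          * Gamma (nu + N%:R + 1 - (k%:R + i%:R - j%:R) / 2)))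
  else 0.

Definition Fmx (R : realType) (N : nat) (nu : R) (k n : nat) : 'M[R]_N.+1 :=
  \matrix_(i, j)
    (n`!%:R * Gamma (nu + N%:R) / 2 ^+ n * gamma_coef N (nu + n%:R) i j k).

(* Main.v *)
(* Let Q_n be the right-hand side, a matrix of polynomials with explicit
   coefficients. Three facts determine everything.
   (i) For a fixed column j, the entries Q_n(i,j) satisfy a three-term recurrence
   expressing X Q_n(i,j) through Q_(n+1)(i,j), Q_n(i-1,j), Q_n(i+1,j) and
   Q_(n-1)(i,j); after clearing Gamma quotients it is a rational identity between
   the coefficients gamma.
   (ii) Q_n' = n Q_(n-1), the right-hand side being taken at nu + 1.
   (iii) The weight satisfies the Pearson equation
   (W^(nu+1))' = W^(nu) Psi with Psi linear in x and tridiagonal.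
   Integrating Q_n (W^(nu+1))' by parts and using (i) to eliminate X Q_n, the
   integral of Q_(n+1) W^(nu) is expressed through integrals of Q_n W^(nu),
   Q_(n-1) W^(nu) and Q_(n-1) W^(nu+1); by induction on n, for all nu at once,
   it vanishes. Then (i) gives that the integral of x^l Q_n W is zero for l < n
   and diagonal with positive entries for l = n.
   As the leading coefficient of Q_n is D_n, descending induction on the degree
   of D_n P_n - Q_n, tested against Q_m = D_m P_m for m < n, gives D_n P_n = Q_n. *)
Require Import Defs.
From HB Require Import structures.
From mathcomp Require Import all_boot all_order all_algebra.
From mathcomp Require Import ring lra zify.
From mathcomp Require Import complex.
From mathcomp Require Import all_classical all_reals all_analysis.
From mathcomp Require Import measurable_realfun.
Set Implicit Arguments.
Unset Strict Implicit.
Unset Printing Implicit Defensive.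
Import Order.TTheory GRing.Theory Num.Theory.
Import numFieldNormedType.Exports.
Local Open Scope classical_set_scope.
Local Open Scope ring_scope.

(** The recurrence (i) acts on the row index i with coefficients free of j, whereas Psi in (iii)
    acts on the column index: one multiplies Q_n W from the left, the other from the right, and the
    integral of x Q_n W occurs in both. The diagonal of Psi is x (j + nu)(N - j + nu) up to a
    nonzero constant, so that integral can be solved for. Integration by parts replaces Q_n at nu by
    Q_(n-1) at nu + 1, which is why nu cannot be fixed in the induction. Two obstacles shape the
    rest. For nu < 1/2 the weight is unbounded at -1 and 1, so the integrals are improper; they are
    handled by exhausting the interval, with a dominating function that has an elementary primitive.
    The same device yields the functional equation of Gamma from Euler's integral. Secondly, the
    finite ranges of gamma and alpha threaten to split each identity into boundary cases; natural
    coordinates (r, s, t, u) for gamma and (p, q, k, u) for alpha turn most missing terms into zero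
    factors of a single rational identity. *)

(** * Improper integrals by exhaustion with compact intervals *)

Section exhaustion.
Variables (R : realType) (D : set R) (a b : R^nat).
Hypothesis a_noninc : nonincreasing_seq a.
Hypothesis b_nondec : nondecreasing_seq b.
Hypothesis ab : forall n, a n < b n.
Hypothesis DE : D = \bigcup_n `[a n, b n]%classic.
Notation mu := (@lebesgue_measure R).

Lemma exhaustion_sub n : `[a n, b n]%classic `<=` D.
Proof. by move=> x xab; rewrite DE; exists n. Qed.

Lemma exhaustion_measurable : measurable D.
Proof. by rewrite DE; apply: bigcup_measurable => n _; exact: measurable_itv. Qed.

Lemma exhaustion_measurable_fun (f : R -> R) :
  (forall x, D x -> {for x, continuous f}) -> measurable_fun D f.
Proof.
move=> cf; rewrite DE; apply/measurable_fun_bigcup.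
  by move=> n; exact: measurable_itv.
move=> n; apply: subspace_continuous_measurable_fun; first exact: measurable_itv.
apply: continuous_in_subspaceT => x; rewrite inE => xab.
by apply: cf; exact: exhaustion_sub xab.
Qed.

(** Monotone convergence along the compact intervals, on each of which the fundamental theorem of
    calculus applies. Since f >= 0, integrability need not be known beforehand: it results from the
    finite limit. *)
Lemma ge0_FTC_exhaustion (f F : R -> R) (l : R) :
  (forall x, D x -> 0 <= f x) ->
  (forall x, D x -> {for x, continuous f}) ->
  (forall x, D x -> is_derive x 1 F (f x)) ->
  F (b n) - F (a n) @[n --> \oo] --> l ->
  (\int[mu]_(x in D) (f x)%:E = l%:E)%E.
Proof.
move=> f0 cf dF Fl.
have mf := exhaustion_measurable_fun cf.
have FTC n : (\int[mu]_(x in `[a n, b n]) (f x)%:E = (F (b n) - F (a n))%:E)%E.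
  have sub := @exhaustion_sub n.
  rewrite EFinB; apply: continuous_FTC2 => //.
  - apply: continuous_in_subspaceT => x; rewrite inE => /sub; exact: cf.
  - have cF : {within `[a n, b n], continuous F}.
      by apply: derivable_within_continuous => x /sub /dF [].
    have [? Fa Fb] := (continuous_within_itvP F (ab n)).1 cF.
    split => //= x xab; have /sub/dF[] // : x \in `[a n, b n].
    exact: subset_itv_oo_cc.
  - move=> x xab; rewrite derive1E; have /sub/dF[] // : x \in `[a n, b n].
    exact: subset_itv_oo_cc.
have cvgD : (\int[mu]_(x in `[a n, b n]) (f x)%:E)%E @[n --> \oo] -->
    (\int[mu]_(x in D) (f x)%:E)%E.
  rewrite [in X in _ --> X]DE; apply: ge0_nondecreasing_set_cvg_integral.
  - move=> m n mn; rewrite subsetEset; apply: subset_itv; rewrite bnd_simp.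
      exact: a_noninc.
    exact: b_nondec.
  - by move=> n; exact: measurable_itv.
  - move=> n; apply/measurable_EFinP; apply: measurable_funS mf.
      exact: exhaustion_measurable.
    exact: exhaustion_sub.
  - by move=> n x xab; rewrite lee_fin; apply: f0; exact: exhaustion_sub xab.
have cvgl : (F (b n) - F (a n))%:E @[n --> \oo] --> l%:E.
  by apply: cvg_EFin => //; exact: nearW.
have FTC' : (fun n => (F (b n) - F (a n))%:E) =
    (fun n => \int[mu]_(x in `[a n, b n]) (f x)%:E)%E.
  by apply/funext => n; rewrite FTC.
rewrite FTC' in cvgl.
by apply: cvg_unique cvgD cvgl; exact: ereal_hausdorff.
Qed.

(** Domination by a function whose primitive G is explicit, so that its integral is visibly
    finite. *)
Lemma exhaustion_integrable (f g G : R -> R) (K l : R) :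
  (forall x, D x -> 0 <= g x) ->
  (forall x, D x -> {for x, continuous g}) ->
  (forall x, D x -> is_derive x 1 G (g x)) ->
  G (b n) - G (a n) @[n --> \oo] --> l ->
  (forall x, D x -> {for x, continuous f}) ->
  (forall x, D x -> `|f x| <= K * g x) ->
  mu.-integrable D (EFin \o f).
Proof.
move=> g0 cg dG Gl cf fg.
have mD := exhaustion_measurable.
have intg : mu.-integrable D (EFin \o g).
  apply/integrableP; split.
    by apply/measurable_EFinP; exact: exhaustion_measurable_fun cg.
  have -> : (\int[mu]_(x in D) `|(EFin \o g) x| = \int[mu]_(x in D) (g x)%:E)%E.
    by apply: eq_integral => x; rewrite inE => /g0 gx /=; rewrite ger0_norm.
  by rewrite (ge0_FTC_exhaustion g0 cg dG Gl) ltry.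
apply: (@le_integrable _ _ _ mu _ mD _ (fun x => K%:E * (EFin \o g) x)%E).
- by apply/measurable_EFinP; exact: exhaustion_measurable_fun cf.
- move=> x Dx /=; rewrite lee_fin (le_trans (fg _ Dx))// ler_norm//.
- exact: integrableZl.
Qed.

(* f is the difference of the nonnegative functions f + K g and K g, to which
   monotone convergence applies. *)
Lemma FTC_exhaustion (f F g G : R -> R) (K l m : R) :
  (forall x, D x -> 0 <= g x) ->
  (forall x, D x -> {for x, continuous g}) ->
  (forall x, D x -> is_derive x 1 G (g x)) ->
  G (b n) - G (a n) @[n --> \oo] --> l ->
  (forall x, D x -> {for x, continuous f}) ->
  (forall x, D x -> `|f x| <= K * g x) ->
  (forall x, D x -> is_derive x 1 F (f x)) ->
  F (b n) - F (a n) @[n --> \oo] --> m ->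
  Rintegral mu D f = m.
Proof.
move=> g0 cg dG Gl cf fg dF Fm.
have mD := exhaustion_measurable.
have intf := exhaustion_integrable g0 cg dG Gl cf fg.
have intg : mu.-integrable D (EFin \o g).
  apply: (exhaustion_integrable (K := 1) g0 cg dG Gl cg) => x Dx.
  by rewrite mul1r ger0_norm// g0.
have intKg : mu.-integrable D (EFin \o (fun x => K * g x)).
  apply: (@eq_integrable _ _ _ mu _ mD (fun x => K%:E * (EFin \o g) x)%E).
    by move=> x _ /=; rewrite EFinM.
  exact: integrableZl.
have -> : Rintegral mu D f =
    Rintegral mu D (fun x => f x + K * g x) - K * Rintegral mu D g.
  by rewrite RintegralD// RintegralZl// addrK.
rewrite {2}/Rintegral (ge0_FTC_exhaustion g0 cg dG Gl)/=.
suff E : (\int[mu]_(x in D) (f x + K * g x)%:E = (m + K * l)%:E)%E.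
  by rewrite /Rintegral E addrK.
apply: (ge0_FTC_exhaustion (F := F + K *: G)).
- by move=> x Dx; rewrite -lerBlDl sub0r (le_trans _ (fg _ Dx))// -normrN ler_norm.
- move=> x Dx; apply: cvgD; first exact: cf.
  by apply: cvgMl_tmp; exact: cg.
- move=> x Dx; have := dF _ Dx; have := dG _ Dx => ? ?.
  exact: is_deriveD.
- have -> : (fun n => (F + K *: G) (b n) - (F + K *: G) (a n)) =
     (fun n => (F (b n) - F (a n)) + K * (G (b n) - G (a n))).
    by apply/funext => n; rewrite !fctE /GRing.scale/=; ring.
  by apply: cvgD => //; apply: cvgMl_tmp.
Qed.

End exhaustion.

(** * Exhaustions of (-1, 1) and of (0, oo), and elementary facts on real powers *)

Section exhausting_sequences.
Variable R : realType.
(** The shift by 2 keeps both kinds of intervals nondegenerate from n = 0 on: [h n - 1 < 1 - h n]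
    and [h n < n.+2]. *)
Notation h := (fun n : nat => (n.+2%:R^-1 : R)).

Lemma cvg_invSS : h n @[n --> \oo] --> (0 : R).
Proof. by have := @cvg_harmonic R; rewrite -cvg_shiftS. Qed.

Lemma invSS_gt0 n : 0 < h n.
Proof. by rewrite invr_gt0 ltr0n. Qed.

Lemma invSS_lt1 n : h n < 1.
Proof. by rewrite invf_lt1 ?ltr0n// ltr1n. Qed.

Lemma nonincreasing_invSS : nonincreasing_seq h.
Proof. by move=> m n mn; rewrite lef_pV2 ?posrE ?ltr0n// ler_nat. Qed.

Lemma ltr_bound_SS (x : R) : 0 <= x -> x < (Num.bound x).+2%:R.
Proof.
by move=> x0; apply: (lt_trans (archi_boundP x0)); rewrite ltr_nat.
Qed.

Lemma itv_m11_exhaustion :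
  `]-1, 1[%classic = \bigcup_n `[(h n - 1 : R), 1 - h n]%classic.
Proof.
apply/seteqP; split => [x|x [n _]]/=; rewrite !in_itv/=.
  move=> /andP[x1 x2].
  have y0 : 0 < 1 - `|x| by rewrite subr_gt0 ltr_norml x1.
  exists (Num.bound (1 - `|x|)^-1) => //=; rewrite in_itv/=.
  have : h (Num.bound (1 - `|x|)^-1) <= 1 - `|x|.
    rewrite invf_ple ?posrE ?ltr0n//.
    by apply/ltW/ltr_bound_SS; rewrite invr_ge0 ltW.
  by rewrite lerBrDl -lerBrDr ler_norml opprB.
move=> /andP[xl xr]; rewrite (lt_le_trans _ xl) ?(le_lt_trans xr)//.
  by rewrite ltrBrDl subrr invSS_gt0.
Qed.

Lemma itv_0y_exhaustion :
  `]0, +oo[%classic = \bigcup_n `[(h n : R), n.+2%:R]%classic.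
Proof.
apply/seteqP; split => [x|x [n _]]/=; rewrite !in_itv/=.
  rewrite andbT => x0.
  exists (Num.bound (x + x^-1)) => //=; rewrite in_itv/=.
  have xV0 : 0 < x^-1 by rewrite invr_gt0.
  have b : x + x^-1 < (Num.bound (x + x^-1)).+2%:R.
    by apply: ltr_bound_SS; rewrite addr_ge0 ?ltW.
  apply/andP; split; last by lra.
  by rewrite invf_ple ?posrE ?ltr0n//; lra.
by move=> /andP[xn _]; rewrite andbT (lt_le_trans (invSS_gt0 n)).
Qed.

Lemma cvg_powR_seq0 (u : R^nat) (s : R) : 0 < s -> (forall n, 0 < u n) ->
  u n @[n --> \oo] --> (0 : R) -> u n `^ s @[n --> \oo] --> (0 : R).
Proof.
move=> s0 u0 uc; have /cvg_at_rightP := powR_cvg0 s0; exact.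
Qed.

(** From t / b <= 1 + t / b <= exp (t / b), raised to the power b. The constant is not sharp, but
    any constant serves for domination. *)
Lemma powR_mul_expRN_le (b t : R) : 0 < b -> 0 < t ->
  t `^ b * expR (- t) <= b `^ b.
Proof.
move=> b0 t0; rewrite expRN ler_pdivrMr ?expR_gt0//.
have -> : expR t = expR (t / b) `^ b.
  by rewrite -expRM divfK ?gt_eqF.
rewrite -powRM ?expR_ge0//; last exact: ltW.
apply: (ge0_ler_powR (ltW b0)); rewrite ?nnegrE ?(ltW t0)//.
  by rewrite mulr_ge0 ?expR_ge0// ltW.
rewrite -ler_pdivrMl// mulrC.
by apply: le_trans (expR_ge1Dx _); rewrite lerDr.
Qed.

Lemma is_derive_continuous (f : R -> R) (x l : R) :
  is_derive x 1 f l -> {for x, continuous f}.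
Proof.
by move=> [df _]; apply: differentiable_continuous; exact/derivable1_diffP.
Qed.

Lemma continuous_powR (s x : R) : 0 < x -> {for x, continuous (@powR R ^~ s)}.
Proof. by move=> x0; have /is_derive_continuous := is_derive1_powR s x0. Qed.

End exhausting_sequences.

Lemma powRD_gt0 (R : realType) (x r s : R) : 0 < x -> x `^ (r + s) = x `^ r * x `^ s.
Proof. by move=> x0; rewrite powRD// (@gt_eqF _ _ x)// implybT. Qed.

Lemma powR_div (R : realType) (x y s : R) : 0 < x -> 0 < y ->
  x `^ s * y `^ (- s) = (x / y) `^ s.
Proof.
move=> x0 y0; have [x0' y0'] := (ltW x0, ltW y0).
rewrite powRM//; last by rewrite invr_ge0.
by rewrite -[y^-1](powR_inv1 y0') -powRrM mulN1r.
Qed.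

Lemma is_derive_powR_comp (R : realType) (u : R -> R) (x du s : R) :
  0 < u x -> is_derive x 1 u du ->
  is_derive x 1 (fun y => u y `^ s) (s * u x `^ (s - 1) * du).
Proof.
move=> u0 Du; have := is_derive1_powR s u0 => Dp.
exact: (is_derive1_comp Dp Du).
Qed.

Lemma Rintegral_itv_gt0 (R : realType) (D : set R) (f : R -> R) (p q c : R) :
  measurable D -> (@lebesgue_measure R).-integrable D (EFin \o f) ->
  (forall x, D x -> 0 <= f x) ->
  p < q -> 0 < c -> `[p, q]%classic `<=` D ->
  (forall x, `[p, q]%classic x -> c <= f x) ->
  0 < Rintegral (@lebesgue_measure R) D f.
Proof.
move=> mD intf f0 pq c0 sub fc.
have mI : measurable `[p, q]%classic by exact: measurable_itv.
have intfI : (@lebesgue_measure R).-integrable `[p, q]%classic (EFin \o f).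
  exact: integrableS intf.
apply: (@lt_le_trans _ _ (Rintegral (@lebesgue_measure R) `[p, q]%classic f)).
  apply: (@lt_le_trans _ _ (c * (q - p))); first by rewrite mulr_gt0 ?subr_gt0.
  have -> : c * (q - p) = Rintegral (@lebesgue_measure R) `[p, q]%classic (cst c).
    by rewrite Rintegral_cst//= lebesgue_measure_itv/= lte_fin pq.
  apply: le_Rintegral => //.
  apply: continuous_compact_integrable; first exact: segment_compact.
  exact: cst_continuous.
rewrite fine_le ?integrable_fin_num//.
apply: ge0_subset_integral => //.
by have /integrableP[] := intf.
Qed.

(** * Euler's integral: convergence, positivity, functional equation *)

Section Gamma_function.
Variable R : realType.
Implicit Types a b t : R.
Notation mu := (@lebesgue_measure R).
Notation h := (fun n : nat => (n.+2%:R^-1 : R)).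

Lemma powR1D_mul_expRN_le b t : 0 < b -> 0 < t ->
  (1 + t) `^ b * expR (- t) <= b `^ b * expR 1.
Proof.
move=> b0 t0; have t10 : 0 < 1 + t by rewrite addr_gt0.
have -> : expR (- t) = expR (- (1 + t)) * expR 1 by rewrite -expRD; congr expR; ring.
by rewrite mulrA ler_pM2r ?expR_gt0 ?powR_mul_expRN_le.
Qed.

(** The dominating function for Euler's integral: it behaves like t^(a-1) near 0 and like t^(-2) at
    infinity, and its primitive is (t / (1 + t))^a / a. *)
Lemma derive_powR_div a t : 0 < a -> 0 < t ->
  is_derive t 1 (fun t => a^-1 * (t `^ a * (1 + t) `^ (- a)))
    (t `^ (a - 1) * (1 + t) `^ (- (a + 1))).
Proof.
move=> a0 t0; have t10 : 0 < 1 + t by rewrite addr_gt0.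
have D1 : is_derive t 1 (fun t : R => 1 + t) 1.
  have D := is_deriveD (is_derive_cst (1 : R) t (1 : R)) (is_derive_id t (1 : R)).
  by apply: (is_derive_eq D); rewrite add0r.
have D2 := is_derive_powR_comp (- a) t10 D1.
have D3 := is_derive1_powR a t0.
have D4 := is_deriveZ a^-1 (is_deriveM D3 D2).
apply: (is_derive_eq D4).
rewrite /GRing.scale/=.
have -> : t `^ a = t * t `^ (a - 1) by rewrite mulr_powRB1// ltW.
have -> : (1 + t) `^ (- a) = (1 + t) * (1 + t) `^ (- a - 1).
  rewrite -[X in _ = X * _]powRr1 ?(ltW t10)// -powRD_gt0//.
  by congr (_ `^ _); ring.
have -> : - (a + 1) = - a - 1 by ring.
by field; rewrite gt_eqF.
Qed.

Lemma cvg_powR_div a : 0 < a ->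
  (fun n => a^-1 * (n.+2%:R `^ a * (1 + n.+2%:R) `^ (- a))
     - a^-1 * (h n `^ a * (1 + h n) `^ (- a))) n @[n --> \oo] --> a^-1.
Proof.
move=> a0.
(* The quotient t / (1 + t) is 1 - u n at t = n + 2 and u n at t = 1 / (n + 2). *)
pose u n : R := n.+3%:R^-1.
have uc : u n @[n --> \oo] --> (0 : R).
  by have := @cvg_invSS R; rewrite -cvg_shiftS.
have u0 n : 0 < u n by rewrite invr_gt0 ltr0n.
have u1 n : 0 < 1 - u n.
  by rewrite subr_gt0 invf_lt1 ?ltr0n// ltr1n.
have -> : (fun n : nat => a^-1 * (n.+2%:R `^ a * (1 + n.+2%:R) `^ (- a))
     - a^-1 * (h n `^ a * (1 + h n) `^ (- a))) =
    (fun n => a^-1 * ((1 - u n) `^ a - u n `^ a)).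
  apply/funext => n; rewrite mulrBr.
  have n2 : 0 < n.+2%:R :> R by rewrite ltr0n.
  have n3 : 0 < n.+3%:R :> R by rewrite ltr0n.
  have n3E : n.+3%:R = 1 + n.+2%:R :> R by rewrite [in LHS]mulrS.
  congr (_ * _ - _ * _).
    rewrite powR_div -?n3E//; congr (_ `^ _).
    rewrite /u n3E; move: n.+2%:R n2 => x x0.
    by field; rewrite gt_eqF// addr_gt0.
  have h0 : 0 < h n by rewrite invr_gt0.
  rewrite powR_div ?addr_gt0//; congr (_ `^ _).
  rewrite /u n3E; move: n.+2%:R n2 => x x0.
  by field; rewrite !gt_eqF// addr_gt0.
rewrite -[X in _ --> X]mulr1; apply: cvgMl_tmp.
rewrite -[X in _ --> X]subr0; apply: cvgB; last exact: cvg_powR_seq0.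
rewrite -[X in _ --> X](_ : 1 `^ a = 1); last by rewrite powR1.
have u1c : 1 - u n @[n --> \oo] --> (1 : R).
  by rewrite -[X in _ --> X]subr0; apply: cvgB => //; exact: cvg_cst.
have pc : {for (1 : R), continuous (@powR R ^~ a)} by exact: continuous_powR.
exact: continuous_cvg pc u1c.
Qed.

Lemma Gamma_integrand_bound a t : 0 < a -> 0 < t ->
  `|t `^ (a - 1) * expR (- t)| <=
  (a + 1) `^ (a + 1) * expR 1 * (t `^ (a - 1) * (1 + t) `^ (- (a + 1))).
Proof.
move=> a0 t0; have t10 : 0 < 1 + t by rewrite addr_gt0.
rewrite ger0_norm ?mulr_ge0 ?powR_ge0 ?expR_ge0// mulrCA ler_wpM2l ?powR_ge0//.
rewrite powRN ler_pdivlMr ?powR_gt0// mulrC.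
by apply: powR1D_mul_expRN_le => //; rewrite addr_gt0.
Qed.

(** The integrands of Gamma (a + 1) and of Gamma a share one dominating function, so that their
    difference falls under [FTC_exhaustion]. The extra factor t costs one more power of 1 + t,
    whence a + 2 in place of a + 1. *)
Lemma Gamma_integrand_bound1 a t : 0 < a -> 0 < t ->
  `|t `^ a * expR (- t)| <=
  (a + 2) `^ (a + 2) * expR 1 * (t `^ (a - 1) * (1 + t) `^ (- (a + 1))).
Proof.
move=> a0 t0; have t10 : 0 < 1 + t by rewrite addr_gt0.
rewrite ger0_norm ?mulr_ge0 ?powR_ge0 ?expR_ge0//.
rewrite -mulr_powRB1 ?(ltW t0)// -mulrA mulrCA.
rewrite [leRHS]mulrCA ler_wpM2l ?powR_ge0//.
rewrite powRN ler_pdivlMr ?powR_gt0//.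
apply: le_trans (powR1D_mul_expRN_le _ t0); last by rewrite addr_gt0.
have -> : a + 2 = 1 + (a + 1) by ring.
rewrite [in leRHS]powRD_gt0// powRr1 ?(ltW t10)// mulrAC ler_wpM2r ?expR_ge0//.
by rewrite ler_wpM2r ?powR_ge0// lerDr.
Qed.

Lemma continuous_expRN t : {for t, continuous (fun t : R => expR (- t))}.
Proof.
by apply: continuous_comp; [exact: opp_continuous|exact: continuous_expR].
Qed.

Lemma continuous_Gamma_integrand a t : 0 < t ->
  {for t, continuous (fun t : R => t `^ a * expR (- t))}.
Proof.
by move=> t0; apply: cvgM; [exact: continuous_powR|exact: continuous_expRN].
Qed.

Lemma Gamma_integrable a : 0 < a ->
  mu.-integrable `]0, +oo[%classic (EFin \o (fun t : R => t `^ (a - 1) * expR (- t))).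
Proof.
move=> a0.
have pos (t : R) : `]0, +oo[%classic t -> 0 < t by rewrite /= in_itv/= andbT.
apply: (exhaustion_integrable (@nonincreasing_invSS R) _ _ (@itv_0y_exhaustion R)
  (g := fun t => t `^ (a - 1) * (1 + t) `^ (- (a + 1)))
  (G := fun t => a^-1 * (t `^ a * (1 + t) `^ (- a)))
  (K := (a + 1) `^ (a + 1) * expR 1)).
- by move=> m n mn; rewrite ler_nat.
- by move=> n; apply: (lt_le_trans (invSS_lt1 R n)); rewrite ler1n.
- by move=> t /pos t0; rewrite mulr_ge0 ?powR_ge0.
- move=> t /pos t0; have t10 : 0 < 1 + t by rewrite addr_gt0.
  apply: cvgM; first exact: continuous_powR.
  apply: (@continuous_comp _ _ _ (fun t => 1 + t) (@powR R ^~ (- (a + 1)))).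
    by apply: cvgD; [exact: cvg_cst|exact: cvg_id].
  exact: continuous_powR.
- by move=> t /pos; exact: derive_powR_div.
- exact: cvg_powR_div.
- by move=> t /pos; exact: continuous_Gamma_integrand.
- by move=> t /pos; exact: Gamma_integrand_bound.
Qed.

Lemma Gamma_gt0 a : 0 < a -> 0 < Gamma a.
Proof.
move=> a0.
(* On [1, 2] one has t^(a-1) >= 1/2 whatever the sign of a - 1, because t^a >= 1 and t <= 2. *)
apply: (@Rintegral_itv_gt0 _ _ _ 1 2 (2^-1 * expR (- 2))).
- exact: measurable_itv.
- exact: Gamma_integrable.
- by move=> t _; rewrite mulr_ge0 ?powR_ge0 ?expR_ge0.
- by rewrite ltr1n.
- by rewrite mulr_gt0 ?expR_gt0.
- move=> t /=; rewrite !in_itv/= andbT => /andP[t1 _].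
  by rewrite (lt_le_trans _ t1).
move=> t /=; rewrite in_itv/= => /andP[t1 t2].
have t0 : 0 < t by rewrite (lt_le_trans _ t1).
apply: ler_pM; rewrite ?expR_ge0 ?ler_expR ?lerN2//.
rewrite -(ler_pM2l t0) mulr_powRB1 ?(ltW t0)// (@le_trans _ _ 1)//.
  by rewrite ler_pdivrMr// mul1r.
by rewrite -(powRr0 t) ler_powR// ltW.
Qed.

(** Integration by parts in one stroke: t^a e^(-t) - a t^(a-1) e^(-t) is the derivative of -t^a
    e^(-t), whose increments along the exhaustion tend to 0. *)
Lemma Gamma_succ a : 0 < a -> Gamma (a + 1) = a * Gamma a.
Proof.
move=> a0; apply/eqP; rewrite -subr_eq0; apply/eqP.
have pos (t : R) : `]0, +oo[%classic t -> 0 < t by rewrite /= in_itv/= andbT.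
have a10 : 0 < a + 1 by rewrite addr_gt0.
have I0 := Gamma_integrable a0.
have I1 := Gamma_integrable a10.
rewrite addrK in I1.
have mD : measurable (`]0, +oo[%classic : set R) by exact: measurable_itv.
rewrite /Gamma addrK -RintegralZl// -RintegralB//; last first.
  apply: (@eq_integrable _ _ _ mu _ mD
    (fun t => a%:E * (EFin \o (fun t : R => t `^ (a - 1) * expR (- t))%R) t)%E).
    by move=> x _ /=; rewrite EFinM.
  exact: integrableZl.
apply: (FTC_exhaustion (@nonincreasing_invSS R) _ _ (@itv_0y_exhaustion R)
  (g := fun t => t `^ (a - 1) * (1 + t) `^ (- (a + 1)))
  (G := fun t => a^-1 * (t `^ a * (1 + t) `^ (- a)))
  (F := fun t => - (t `^ a * expR (- t)))
  (K := (a + 2) `^ (a + 2) * expR 1 + a * ((a + 1) `^ (a + 1) * expR 1))).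
- by move=> m n mn; rewrite ler_nat.
- by move=> n; apply: (lt_le_trans (invSS_lt1 R n)); rewrite ler1n.
- by move=> t /pos t0; rewrite mulr_ge0 ?powR_ge0.
- move=> t /pos t0; have t10 : 0 < 1 + t by rewrite addr_gt0.
  apply: cvgM; first exact: continuous_powR.
  apply: (@continuous_comp _ _ _ (fun t => 1 + t) (@powR R ^~ (- (a + 1)))).
    by apply: cvgD; [exact: cvg_cst|exact: cvg_id].
  exact: continuous_powR.
- by move=> t /pos; exact: derive_powR_div.
- exact: cvg_powR_div.
- move=> t /pos t0; apply: cvgB; first exact: continuous_Gamma_integrand.
  apply: cvgMl_tmp; exact: continuous_Gamma_integrand.
- move=> t /pos t0; rewrite (le_trans (ler_normB _ _))// mulrDl lerD//.
    exact: Gamma_integrand_bound1.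
  by rewrite normrM (ger0_norm (ltW a0)) -mulrA ler_pM2l// Gamma_integrand_bound.
- move=> t /pos t0.
  have D1 := is_derive1_powR a t0.
  have D2 : is_derive t 1 (fun t : R => expR (- t)) (- expR (- t)).
    have D := is_derive1_comp (is_derive_expR (- t)) (is_deriveNid t 1).
    by apply: (is_derive_eq D); rewrite mulrN1.
  have D3 := is_deriveN (is_deriveM D1 D2).
  by apply: (is_derive_eq D3); rewrite /GRing.scale/=; ring.
have hc : h n @[n --> \oo] --> (0 : R) by exact: cvg_invSS.
have [hp pow0] := (@invSS_gt0 R, cvg_powR_seq0 a0 (@invSS_gt0 R) hc).
(* [powR_mul_expRN_le] with exponent a + 1 gives t^a e^(-t) <= C / t, that is, C * h n at t = n +
   2. *)
set C := (a + 1) `^ (a + 1).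
apply: (@squeeze_cvgr _ _ _ _ (fun n => - (C * h n)) (fun n => h n `^ a)).
- near=> n.
  have n2 : 0 < n.+2%:R :> R by rewrite ltr0n.
  have top : n.+2%:R `^ a * expR (- n.+2%:R) <= C * h n.
    rewrite ler_pdivlMr// mulrC mulrA.
    rewrite -[X in X * n.+2%:R `^ _]powRr1 ?(ltW n2)// -powRD_gt0//.
    by rewrite addrC; exact: powR_mul_expRN_le.
  have top0 : 0 <= n.+2%:R `^ a * expR (- n.+2%:R) :> R.
    by rewrite mulr_ge0 ?powR_ge0 ?expR_ge0.
  have bot0 : 0 <= h n `^ a * expR (- h n) by rewrite mulr_ge0 ?powR_ge0 ?expR_ge0.
  have bot : h n `^ a * expR (- h n) <= h n `^ a.
    by rewrite ler_piMr ?powR_ge0// -expR0 ler_expR lerNl oppr0 ltW ?hp.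
  have aux (A B r s : R) : 0 <= A -> A <= r -> 0 <= B -> B <= s ->
      - r <= - A - - B <= s by move=> *; apply/andP; split; lra.
  exact: aux.
- by rewrite -oppr0; apply: cvgN; rewrite -(mulr0 C); exact: cvgMl_tmp.
- exact: pow0.
Unshelve. all: by end_near. Qed.

End Gamma_function.

(** * Integration of polynomials against the scalar weight (1 - x^2)^(nu - 1/2) *)

Section ultraspherical_moment.
Variable R : realType.
Implicit Types (nu x : R) (p q : {poly R}).
Notation mu := (@lebesgue_measure R).
Notation h := (fun n : nat => (n.+2%:R^-1 : R)).

Definition moment nu p : R :=
  Rintegral mu `]-1, 1[%classic (fun x => (1 - x ^+ 2) `^ (nu - 2^-1) * p.[x]).

(* The weight is at most 2 `^ nu * dom nu for every nu > 0, and dom nu, unlike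
   the weight, has an elementary primitive. *)
Let dom nu x := (1 - x) `^ (nu - 1) + (1 + x) `^ (nu - 1).
Let Dom nu x := nu^-1 * ((1 + x) `^ nu - (1 - x) `^ nu).

Lemma itv_m11P x : `]-1, 1[%classic x -> [/\ 0 < 1 - x, 0 < 1 + x & 0 < 1 - x ^+ 2].
Proof.
rewrite /= in_itv/= => /andP[x1 x2].
have [y1 y2] : 0 < 1 - x /\ 0 < 1 + x by split; lra.
split=> //; have -> : 1 - x ^+ 2 = (1 - x) * (1 + x) by ring.
by rewrite mulr_gt0.
Qed.

Let dom_ge0 nu x : 0 <= dom nu x.
Proof. by rewrite addr_ge0 ?powR_ge0. Qed.

Lemma continuous_powR_affine (c s x : R) : 0 < 1 + c * x ->
  {for x, continuous (fun x => (1 + c * x) `^ s)}.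
Proof.
move=> u0; apply: (@is_derive_continuous _ _ _ (s * (1 + c * x) `^ (s - 1) * c)).
apply: is_derive_powR_comp => //.
have D := is_deriveD (is_derive_cst (1 : R) x (1 : R))
  (is_deriveZ c (is_derive_id x (1 : R))).
by apply: (is_derive_eq D); rewrite add0r /GRing.scale/= mulr1.
Qed.

Let continuous_dom nu x : `]-1, 1[%classic x -> {for x, continuous (dom nu)}.
Proof.
move=> /itv_m11P[x1 x2 _].
have -> : dom nu = (fun x => (1 + - 1 * x) `^ (nu - 1) + (1 + 1 * x) `^ (nu - 1)).
  by apply/funext => y; rewrite mulN1r mul1r.
by apply: cvgD; apply: continuous_powR_affine; rewrite ?mulN1r ?mul1r.
Qed.

Let derive_Dom nu x : 0 < nu -> `]-1, 1[%classic x ->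
  is_derive x 1 (Dom nu) (dom nu x).
Proof.
move=> nu0 /itv_m11P[x1 x2 _].
have E1 : is_derive x 1 (fun x : R => 1 - x) (- 1).
  have D := is_deriveB (is_derive_cst (1 : R) x (1 : R)) (is_derive_id x (1 : R)).
  by apply: (is_derive_eq D); rewrite sub0r.
have E2 : is_derive x 1 (fun x : R => 1 + x) 1.
  have D := is_deriveD (is_derive_cst (1 : R) x (1 : R)) (is_derive_id x (1 : R)).
  by apply: (is_derive_eq D); rewrite add0r.
have D1 := is_derive_powR_comp (u := fun x => 1 - x) nu x1 E1.
have D2 := is_derive_powR_comp (u := fun x => 1 + x) nu x2 E2.
apply: (is_derive_eq (is_deriveZ nu^-1 (is_deriveB D2 D1))).
by rewrite /GRing.scale/= /dom; field; rewrite gt_eqF.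
Qed.

Let cvg_Dom nu : 0 < nu ->
  Dom nu (1 - h n) - Dom nu (h n - 1) @[n --> \oo] --> nu^-1 * (2 * 2 `^ nu).
Proof.
move=> nu0; have hc : h n @[n --> \oo] --> (0 : R) by exact: cvg_invSS.
have -> : (fun n => Dom nu (1 - h n) - Dom nu (h n - 1)) =
    (fun n => nu^-1 * (2 * ((2 - h n) `^ nu - h n `^ nu))).
  apply/funext => n; rewrite /Dom.
  have -> : 1 + (1 - h n) = 2 - h n by ring.
  have -> : 1 - (h n - 1) = 2 - h n by ring.
  have -> : 1 - (1 - h n) = h n by ring.
  have -> : 1 + (h n - 1) = h n by ring.
  by ring.
do 2 apply: cvgMl_tmp.
rewrite -[X in _ --> X]subr0; apply: cvgB; last first.
  by apply: cvg_powR_seq0 => //; exact: invSS_gt0.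
have uc : 2 - h n @[n --> \oo] --> (2 : R).
  by rewrite -[X in _ --> X]subr0; apply: cvgB => //; exact: cvg_cst.
have pc : {for (2 : R), continuous (@powR R ^~ nu)} by exact: continuous_powR.
exact: continuous_cvg pc uc.
Qed.

(** As 0 < 1 - x^2 <= 1, the exponent may be lowered to nu - 1, where the weight factors into powers
    of 1 - x and 1 + x. Whichever of these two lies in [1, 2] contributes at most 2^nu. *)
Let ultraspherical_weight_le nu x : 0 < nu -> `]-1, 1[%classic x ->
  (1 - x ^+ 2) `^ (nu - 2^-1) <= 2 `^ nu * dom nu x.
Proof.
move=> nu0 xD; have [x1 x2 x12] := itv_m11P xD.
have x1_le1 : 1 - x ^+ 2 <= 1 by rewrite gerBl sqr_ge0.
apply: (@le_trans _ _ ((1 - x ^+ 2) `^ (nu - 1))).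
  by apply: ger_powR; [rewrite x12|lra].
have -> : 1 - x ^+ 2 = (1 - x) * (1 + x) by ring.
rewrite powRM ?(ltW x1) ?(ltW x2)//.
have key y : 1 <= y -> y <= 2 -> y `^ (nu - 1) <= 2 `^ nu.
  move=> y1 y2; apply: (@le_trans _ _ (y `^ nu)).
    by apply: ler_powR => //; lra.
  by apply: (ge0_ler_powR (ltW nu0)) => //; rewrite nnegrE; lra.
rewrite mulrDr; move: xD; rewrite /= in_itv/= => /andP[xl xr].
have [x0|x0] := leP 0 x.
  rewrite ler_wpDr ?mulr_ge0 ?powR_ge0// mulrC ler_wpM2r ?powR_ge0// key//; lra.
by rewrite ler_wpDl ?mulr_ge0 ?powR_ge0// ler_wpM2r ?powR_ge0// key//; lra.
Qed.

Let integrand_bound nu p (B : R) x : 0 < nu -> `]-1, 1[%classic x ->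
  (forall x, -1 <= x <= 1 -> `|p.[x]| <= B) ->
  `|(1 - x ^+ 2) `^ (nu - 2^-1) * p.[x]| <= B * 2 `^ nu * dom nu x.
Proof.
move=> nu0 xD pB; rewrite normrM ger0_norm ?powR_ge0// mulrC -mulrA.
apply: ler_pM; rewrite ?powR_ge0//; last exact: ultraspherical_weight_le.
by apply: pB; move: xD; rewrite /= in_itv/= => /andP[? ?]; apply/andP; split; lra.
Qed.

Let derive_1mx2 x : is_derive x 1 (fun x : R => 1 - x ^+ 2) (- (2 * x)).
Proof.
have D := is_deriveB (is_derive_cst (1 : R) x (1 : R))
  (is_deriveX 2 (is_derive_id x (1 : R))).
apply: (is_derive_eq D); rewrite sub0r /GRing.scale/= mulr1 expr1.
by [].
Qed.

Let continuous_integrand (s : R) p x : `]-1, 1[%classic x ->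
  {for x, continuous (fun x => (1 - x ^+ 2) `^ s * p.[x])}.
Proof.
move=> /itv_m11P[_ _ x12]; apply: cvgM; last exact: continuous_horner.
have D := is_derive_powR_comp (u := fun x => 1 - x ^+ 2) s x12 (derive_1mx2 x).
exact: (is_derive_continuous D).
Qed.

Lemma nondecreasing_1BinvSS : nondecreasing_seq (fun n => 1 - h n).
Proof. by move=> m n mn; rewrite lerD2l lerN2; exact: nonincreasing_invSS. Qed.

Lemma nonincreasing_invSSB1 : nonincreasing_seq (fun n => h n - 1).
Proof. by move=> m n mn; rewrite lerD2r; exact: nonincreasing_invSS. Qed.

Lemma invSSB1_lt n : h n - 1 < 1 - h n.
Proof. by have /= := invSS_lt1 R n; move: (n.+2%:R^-1) => y; lra. Qed.

Lemma moment_integrable nu p : 0 < nu ->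
  mu.-integrable `]-1, 1[%classic
    (EFin \o (fun x => (1 - x ^+ 2) `^ (nu - 2^-1) * p.[x])).
Proof.
move=> nu0; have [B pB] := poly_itv_bound p (-1) 1.
apply: (exhaustion_integrable nonincreasing_invSSB1 nondecreasing_1BinvSS
  invSSB1_lt (@itv_m11_exhaustion R) (g := dom nu) (G := Dom nu)
  (K := B * 2 `^ nu)) => //.
- by move=> x xD; exact: continuous_dom.
- by move=> x xD; exact: derive_Dom.
- exact: cvg_Dom.
- by move=> x xD; exact: continuous_integrand.
- by move=> x xD; exact: integrand_bound.
Qed.

Let mD : measurable (`]-1, 1[%classic : set R).
Proof. exact: measurable_itv. Qed.

Lemma momentD nu p q : 0 < nu -> moment nu (p + q) = moment nu p + moment nu q.
Proof.
move=> nu0; rewrite /moment -RintegralD//; try exact: moment_integrable.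
by apply: eq_Rintegral => x _; rewrite hornerD mulrDr.
Qed.

Lemma momentZ nu (c : R) p : 0 < nu -> moment nu (c *: p) = c * moment nu p.
Proof.
move=> nu0; rewrite /moment -RintegralZl//; try exact: moment_integrable.
by apply: eq_Rintegral => x _; rewrite hornerZ mulrCA.
Qed.

Lemma moment0 nu : 0 < nu -> moment nu 0 = 0.
Proof. by move=> nu0; rewrite -(scale0r 0) momentZ// mul0r. Qed.

Lemma momentB nu p q : 0 < nu -> moment nu (p - q) = moment nu p - moment nu q.
Proof. by move=> nu0; rewrite momentD// -scaleN1r momentZ// mulN1r. Qed.

Lemma moment_sum nu I (r : seq I) (P : pred I) (F : I -> {poly R}) : 0 < nu ->
  moment nu (\sum_(i <- r | P i) F i) = \sum_(i <- r | P i) moment nu (F i).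
Proof.
move=> nu0; apply: (big_morph (moment nu)); last exact: moment0.
by move=> p q; exact: momentD.
Qed.

Lemma moment_gt0 nu : 0 < nu -> 0 < moment nu 1.
Proof.
move=> nu0.
(* On [0, 1/2] the base lies in [3/4, 1]. Raising the exponent to nu + 1/2 only decreases the power
   and makes it increasing in the base, which settles both signs of nu - 1/2. *)
apply: (@Rintegral_itv_gt0 _ _ _ 0 2^-1 ((3 / 4) `^ (nu + 2^-1))) => //.
- exact: moment_integrable.
- by move=> x _; rewrite hornerC mulr1 powR_ge0.
- by move=> x /=; rewrite !in_itv/= => /andP[? ?]; apply/andP; split; lra.
move=> x /=; rewrite in_itv/= hornerC mulr1 => /andP[x0 x1].
have x2 : x ^+ 2 <= 4^-1 by rewrite expr2; nra.
have x20 : 0 <= x ^+ 2 by rewrite sqr_ge0.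
have [y0 y1] : 3 / 4 <= 1 - x ^+ 2 /\ 1 - x ^+ 2 <= 1 by split; lra.
apply: (@le_trans _ _ ((1 - x ^+ 2) `^ (nu + 2^-1))).
  apply: ge0_ler_powR => //; rewrite ?nnegrE ?divr_ge0//; lra.
by apply: ger_powR; [apply/andP; split|]; lra.
Qed.

Lemma moment_succ nu p : 0 < nu ->
  moment (nu + 1) p = moment nu ((1 - 'X^2) * p).
Proof.
move=> nu0; have E x : ((1 - 'X^2) * p).[x] = (1 - x ^+ 2) * p.[x] by rewrite !hornerE.
apply: eq_Rintegral => x; rewrite inE => /itv_m11P[_ _ x12].
rewrite E mulrA; congr (_ * _).
have -> : nu + 1 - 2^-1 = nu - 2^-1 + 1 by ring.
by rewrite powRD_gt0// powRr1// ltW.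
Qed.

(** The integrand is the derivative of (1 - x^2)^(nu + 1/2) p, which tends to 0 at both ends since
    nu + 1/2 > 0. This is the only integration by parts on (-1, 1). *)
Lemma moment_pearson nu p : 0 < nu ->
  moment nu ((1 - 'X^2) * p^`() - (2 * nu + 1) *: ('X * p)) = 0.
Proof.
move=> nu0; set q := _ - _.
have qE x : q.[x] = (1 - x ^+ 2) * p^`().[x] - (2 * nu + 1) * (x * p.[x]).
  by rewrite !hornerE.
have [B qB] := poly_itv_bound q (-1) 1.
have [C pC] := poly_itv_bound p (-1) 1.
apply: (FTC_exhaustion nonincreasing_invSSB1 nondecreasing_1BinvSS
  invSSB1_lt (@itv_m11_exhaustion R) (g := dom nu) (G := Dom nu)
  (F := fun x => (1 - x ^+ 2) `^ (nu + 2^-1) * p.[x]) (K := B * 2 `^ nu)) => //.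
- by move=> x xD; exact: continuous_dom.
- by move=> x xD; exact: derive_Dom.
- exact: cvg_Dom.
- by move=> x xD; exact: continuous_integrand.
- by move=> x xD; exact: integrand_bound.
- move=> x /itv_m11P[_ _ x12].
  have D1 := is_derive_powR_comp (u := fun x => 1 - x ^+ 2) (nu + 2^-1) x12 (derive_1mx2 x).
  apply: (is_derive_eq (is_deriveM D1 (is_derive_poly p x))).
  have -> : nu + 2^-1 - 1 = nu - 2^-1 by field.
  have -> : nu + 2^-1 = nu - 2^-1 + 1 by field.
  rewrite /GRing.scale/= powRD_gt0// powRr1 ?(ltW x12)//.
  rewrite qE; move: (_ `^ _) p^`().[x] p.[x] => u v w.
  by field.
have hc : h n @[n --> \oo] --> (0 : R) by exact: cvg_invSS.
have nu1 : 0 < nu + 2^-1 by rewrite addr_gt0.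
have := cvg_powR_seq0 nu1 (@invSS_gt0 R) hc.
set u := (X in X @ _ --> _) => uc.
pose K := 2 `^ (nu + 2^-1) * C.
have C0 : 0 <= C by apply: le_trans (pC 0 _); rewrite // oppr_le0 ler01.
(* Both end points y = 1 - h n and y = h n - 1 satisfy this equation. *)
have end_bound y n : 1 - y ^+ 2 = h n * (2 - h n) -> -1 <= y <= 1 ->
    `|(1 - y ^+ 2) `^ (nu + 2^-1) * p.[y]| <= K * u n.
  move=> -> y1; have hn := invSS_gt0 R n; have hn1 := invSS_lt1 R n.
  rewrite normrM ger0_norm ?powR_ge0// /K mulrAC; apply: ler_pM => //.
  - exact: powR_ge0.
  - rewrite powRM ?(ltW hn)//; last by rewrite subr_ge0 (le_trans (ltW hn1))// ler1n.
    rewrite mulrC ler_wpM2r ?powR_ge0//; apply: (ge0_ler_powR (ltW nu1)) => //.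
    + by rewrite nnegrE subr_ge0 (le_trans (ltW hn1))// ler1n.
    + by rewrite nnegrE.
    + by rewrite gerBl ltW.
  - exact: pC.
apply: (@squeeze_cvgr _ _ _ _ (fun n => - (2 * K * u n)) (fun n => 2 * K * u n)).
- near=> n; rewrite -ler_norml.
  have hn := invSS_gt0 R n; have hn1 := invSS_lt1 R n.
  rewrite (le_trans (ler_normB _ _))//.
  have -> : 2 * K * u n = K * u n + K * u n by ring.
  have hb1 : -1 <= 1 - h n <= 1 by move: hn hn1 => /=; move: (n.+2%:R^-1) => y; lra.
  have hb2 : -1 <= h n - 1 <= 1 by move: hn hn1 => /=; move: (n.+2%:R^-1) => y; lra.
  by apply: lerD; apply: end_bound => //; ring.
- by rewrite -oppr0; apply: cvgN; rewrite -(mulr0 (2 * K)); exact: cvgMl_tmp.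
- by rewrite -(mulr0 (2 * K)); exact: cvgMl_tmp.
Unshelve. all: by end_near. Qed.

End ultraspherical_moment.

Lemma natr_fact_neq0 (R : numDomainType) n : n`!%:R != 0 :> R.
Proof. by rewrite pnatr_eq0 -lt0n fact_gt0. Qed.

Lemma natr_factS (R : pzSemiRingType) n : n.+1`!%:R = n.+1%:R * n`!%:R :> R.
Proof. by rewrite factS natrM. Qed.

Lemma natr1_neq0 (R : numDomainType) n : n%:R + 1 != 0 :> R.
Proof. by rewrite natr1 pnatr_eq0. Qed.

Lemma deriv_sum (R : nzRingType) n (F : 'I_n -> {poly R}) :
  (\sum_(i < n) F i)^`() = \sum_(i < n) (F i)^`().
Proof. exact: raddf_sum. Qed.

(** * Pochhammer symbols *)

Section pochhammer_theory.
Variable R : realType.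
Implicit Types a : R.

Lemma pochhammer0 a : pochhammer a 0 = 1.
Proof. by rewrite /pochhammer big_ord0. Qed.

Lemma pochhammerS a k : pochhammer a k.+1 = pochhammer a k * (a + k%:R).
Proof. by rewrite /pochhammer big_ord_recr. Qed.

Lemma pochhammerSl a k : pochhammer a k.+1 = a * pochhammer (a + 1) k.
Proof.
rewrite /pochhammer big_ord_recl addr0; congr (_ * _).
by apply: eq_bigr => i _; rewrite lift0 -addrA nat1r.
Qed.

Lemma pochhammer_gt0 a k : 0 < a -> 0 < pochhammer a k.
Proof. by move=> a0; apply: prodr_gt0 => i _; rewrite ltr_wpDr. Qed.

Lemma Gamma_pochhammer a k : 0 < a -> Gamma (a + k%:R) = pochhammer a k * Gamma a.
Proof.
move=> a0; elim: k => [|k IH]; first by rewrite addr0 pochhammer0 mul1r.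
have ak0 : 0 < a + k%:R by rewrite ltr_wpDr.
by rewrite -natr1 addrA (Gamma_succ ak0) IH pochhammerS mulrCA mulrA.
Qed.

End pochhammer_theory.

(** * Scalar Gegenbauer polynomials: recurrence, lowering and raising operators *)

Section gegenbauer_theory.
Variables (R : realType).
Implicit Types lam : R.

(** The coefficient of x^e in C_(e + 2k). Indexing by the exponent instead of the degree avoids
    truncated subtraction. *)
Definition gegenbauer_coef lam (e k : nat) : R :=
  (-1) ^+ k * pochhammer lam (e + k) * 2 ^+ e / (k`!%:R * e`!%:R).

Lemma gegenbauerE lam n : 0 < lam -> gegenbauer lam n =
  \sum_(k < n./2.+1) gegenbauer_coef lam (n - k.*2) k *: 'X^(n - k.*2).
Proof.
move=> lam0; apply: eq_bigr => -[k /= kn] _.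
have -> : (2 *: 'X : {poly R}) = 2%:P * 'X by rewrite mul_polyC.
rewrite exprMn -polyC_exp mul_polyC scalerA; congr (_ *: _).
have -> : (n - k = n - k.*2 + k)%N by lia.
rewrite Gamma_pochhammer// /gegenbauer_coef.
by field; rewrite !pnatr_eq0 -!lt0n !fact_gt0 gt_eqF// Gamma_gt0.
Qed.

Lemma gegenbauer_coefE lam e k : 0 < lam ->
  (gegenbauer lam (e + k.*2))`_e = gegenbauer_coef lam e k.
Proof.
move=> lam0; rewrite gegenbauerE// coef_sum.
have kn : (k < (e + k.*2)./2.+1)%N by lia.
rewrite (bigD1 (Ordinal kn))//= addnK coefZ coefXn eqxx mulr1 big1 ?addr0//.
move=> i /eqP ik; rewrite coefZ coefXn; case: eqP => [ei|_]; rewrite ?mulr0//.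
by case: ik; apply: val_inj => /=; have := ltn_ord i; lia.
Qed.

Lemma gegenbauer_coef0 lam n e : 0 < lam -> (forall k, n <> e + k.*2)%N ->
  (gegenbauer lam n)`_e = 0.
Proof.
move=> lam0 nek; rewrite gegenbauerE// coef_sum big1// => -[k /= kn] _.
rewrite coefZ coefXn; case: eqP => [ek|_]; rewrite ?mulr0//.
by case: (nek k); lia.
Qed.

Lemma gegenbauer0 lam : 0 < lam -> gegenbauer lam 0 = 1.
Proof.
move=> lam0; rewrite gegenbauerE// big_ord_recl big_ord0 addr0 expr0.
by rewrite /gegenbauer_coef pochhammer0 !expr0 !mulr1 divr1 scale1r.
Qed.

(* The convention C_{-1} = 0. *)
Definition gegenbauer_pred lam n : {poly R} :=
  if n is m.+1 then gegenbauer lam m else 0.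

Let parity_split e n : (exists k, n = e + k.*2)%N \/ (forall k, n <> e + k.*2)%N.
Proof.
have [h|h] := boolP ((e <= n)%N && ~~ odd (n - e)).
  by left; exists (n - e)./2; lia.
by right => k nk; move: h; rewrite nk; lia.
Qed.

Local Ltac nonzero :=
  repeat (apply/andP; split); rewrite ?natr_fact_neq0//; apply: lt0r_neq0;
  rewrite ?addr_gt0 ?mulr_gt0 ?ltr0n ?ltr_wpDl ?ltr_wpDr.

(** The classical recurrence, compared at x^e with n + 1 = e + 2k: the term with X is absent for e =
    0, the one with C_(n-1) for k = 0, and otherwise a rational identity in e, k, lam remains. *)
Lemma gegenbauer_ttr lam n : 0 < lam ->
  (n%:R + lam) *: ('X * gegenbauer lam n) =
  2^-1 *: (n.+1%:R *: gegenbauer lam n.+1 +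
           (n%:R + 2 * lam - 1) *: gegenbauer_pred lam n).
Proof.
move=> lam0; apply/polyP => e; rewrite !coefZ coefD !coefZ coefXM.
case: (parity_split e n.+1) => [[k nk]|nk].
- rewrite [in gegenbauer lam n.+1]nk gegenbauer_coefE//.
  case: e k nk => [|e] [|k] nk.
  + lia.
  + have -> : n = k.*2.+1 by lia.
    rewrite /= -[gegenbauer lam k.*2]/(gegenbauer lam (0 + k.*2)) gegenbauer_coefE//.
    rewrite /gegenbauer_coef !add0n pochhammerS exprS natr_factS -!addnn fact0 expr0.
    field; nonzero.
  + have -> : n = e by lia.
    have nE : e = (e + 0.*2)%N by lia.
    rewrite /= [in gegenbauer lam e]nE gegenbauer_coefE//.
    have -> : (gegenbauer_pred lam e)`_e.+1 = 0.
      by case: e {nk nE} => [|e]; rewrite ?coef0 ?gegenbauer_coef0//; lia.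
    rewrite /gegenbauer_coef !addn0 pochhammerS exprS natr_factS.
    field; nonzero.
  + have nE : n = (e + k.+1.*2)%N by lia.
    have n'E : n = (e.+1 + k.*2).+1 by lia.
    have nR : n%:R = e%:R + 2 * k%:R + 2 :> R.
      by rewrite nE doubleS -addnn; ring.
    have -> : (gegenbauer lam n)`_e.+1.-1 = gegenbauer_coef lam e k.+1.
      by rewrite nE gegenbauer_coefE.
    have -> : (gegenbauer_pred lam n)`_e.+1 = gegenbauer_coef lam e.+1 k.
      by rewrite n'E /= gegenbauer_coefE.
    rewrite /= /gegenbauer_coef -[n.+1%:R]natr1 nR.
    rewrite !addnS !addSn !pochhammerS !exprS !natr_factS.
    field; nonzero.
- rewrite (gegenbauer_coef0 lam0 nk) mulr0 add0r.
  have -> : (gegenbauer_pred lam n)`_e = 0.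
    case: n nk => [|n] nk; first by rewrite coef0.
    by rewrite /= gegenbauer_coef0// => k; have := nk k.+1; lia.
  case: e nk => [|e] nk; first by rewrite !mulr0.
  rewrite /= gegenbauer_coef0 ?mulr0// => k; have := nk k; lia.
Qed.

Lemma deriv_gegenbauer lam n : 0 < lam ->
  (gegenbauer lam n)^`() = (2 * lam) *: gegenbauer_pred (lam + 1) n.
Proof.
move=> lam0; have lam1 : 0 < lam + 1 by rewrite addr_gt0.
apply/polyP => e; rewrite coef_deriv coefZ.
case: (parity_split e.+1 n) => [[k ->]|nk].
  rewrite gegenbauer_coefE// addSn /= gegenbauer_coefE// /gegenbauer_coef.
  rewrite addSn pochhammerSl exprS natr_factS -[_ *+ e.+1]mulr_natr.
  field; nonzero.
rewrite gegenbauer_coef0// mul0rn.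
case: n nk => [|n] nk; first by rewrite coef0 mulr0.
by rewrite /= gegenbauer_coef0 ?mulr0// => k; have := nk k; lia.
Qed.

(** The operator on the left is the adjoint of differentiation: multiplied by (1 - x^2)^(lam - 1/2)
    it is the derivative of (1 - x^2)^(lam + 1/2) C_n. It gives both the vanishing moments of
    C_(n+1) and the scalar ingredient of the matrix Pearson equation. *)
Lemma gegenbauer_raise lam n : 0 < lam ->
  (1 - 'X^2) * (gegenbauer (lam + 1) n)^`() -
    (2 * lam + 1) *: ('X * gegenbauer (lam + 1) n) =
  - (n.+1%:R * (n%:R + 2 * lam + 1) / (2 * lam)) *: gegenbauer lam n.+1.
Proof.
move=> lam0; have lam1 : 0 < lam + 1 by rewrite addr_gt0.
have lam_neq0 : lam != 0 by rewrite gt_eqF.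
rewrite mulrBl mul1r; apply/polyP => e.
rewrite !coefD !coefN !coefZ coefXM coefXnM !coef_deriv.
case: (parity_split e n.+1) => [[k nk]|nk].
- rewrite [in gegenbauer lam n.+1]nk gegenbauer_coefE//.
  case: e k nk => [|[|e]] [|k] nk.
  + lia.
  + have -> : n = (1 + k.*2)%N by lia.
    rewrite /= gegenbauer_coefE// /gegenbauer_coef !add0n add1n.
    rewrite (pochhammerSl lam) !pochhammerS !exprS !natr_factS -!addnn !fact0 expr0.
    field; nonzero.
  + have -> : (gegenbauer (lam + 1) n)`_2 = 0 by rewrite gegenbauer_coef0// => k; lia.
    have -> : n = 0%N by lia.
    rewrite /= gegenbauer0// coef1 mul0rn /gegenbauer_coef !addn0 !pochhammerS !pochhammer0.
    by rewrite (factS 0) !fact0 /=; field; rewrite lam_neq0.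
  + have n1 : n = (2 + k.*2)%N by lia.
    have n2 : n = (0 + k.+1.*2)%N by lia.
    have -> : (gegenbauer (lam + 1) n)`_2 = gegenbauer_coef (lam + 1) 2 k.
      by rewrite n1 gegenbauer_coefE.
    have -> : (gegenbauer (lam + 1) n)`_1.-1 = gegenbauer_coef (lam + 1) 0 k.+1.
      by rewrite n2 gegenbauer_coefE.
    have nR : n%:R = 2 * k%:R + 2 :> R by rewrite n1 -addnn; ring.
    rewrite /= /gegenbauer_coef -[n.+1%:R]natr1 nR !add0n !addSn add0n.
    rewrite (pochhammerSl lam) !pochhammerS !exprS (natr_factS R k) (factS 1) (factS 0).
    rewrite fact0.
    field; nonzero.
  + have -> : (gegenbauer (lam + 1) n)`_e.+3 = 0.
      by rewrite gegenbauer_coef0// => k; lia.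
    have nE : n = (e.+1 + 0.*2)%N by lia.
    rewrite /= subn2 /= [in gegenbauer _ n]nE !gegenbauer_coefE//.
    have -> : n = e.+1 by lia.
    rewrite mul0rn /gegenbauer_coef !addn0 (pochhammerSl lam) !pochhammerS !exprS !natr_factS.
    field; nonzero.
  + have n1 : n = (e.+3 + k.*2)%N by lia.
    have n2 : n = (e.+1 + k.+1.*2)%N by lia.
    have -> : (gegenbauer (lam + 1) n)`_e.+3 = gegenbauer_coef (lam + 1) e.+3 k.
      by rewrite n1 gegenbauer_coefE.
    have E : (gegenbauer (lam + 1) n)`_e.+1 = gegenbauer_coef (lam + 1) e.+1 k.+1.
      by rewrite n2 gegenbauer_coefE.
    rewrite /= subn2 /= E /gegenbauer_coef.
    rewrite n1 !addnS !addSn (pochhammerSl lam) !pochhammerS !exprS !natr_factS -?addnn.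
    field; nonzero.
- rewrite (gegenbauer_coef0 lam0 nk) mulr0.
  have -> : (gegenbauer (lam + 1) n)`_e.+1 = 0.
    by rewrite gegenbauer_coef0// => k; have := nk k.+1; lia.
  case: e nk => [|[|e]] nk.
  + by rewrite /= mul0rn mulr0; ring.
  + rewrite /= gegenbauer_coef0// ?mul0rn ?mulr0 ?subr0// => k; have := nk k; lia.
  + rewrite /= subn2 /= gegenbauer_coef0// ?mul0rn ?mulr0 ?subr0// => k; have := nk k; lia.
Qed.

End gegenbauer_theory.

(** * The coefficients gamma in multinomial coordinates *)

Section gamma_coefficients.
Variables (R : realType) (N : nat).
Implicit Types (a nu : R) (i j k n r s t u : nat).

Lemma binz_half (m : nat) (z : int) b : z = (m%:Z * 2)%R -> binz b (z %/ 2)%Z = 'C(b, m).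
Proof. by move=> ->; rewrite mulzK. Qed.

(** In these coordinates the halves disappear and the three binomials merge into one multinomial
    coefficient. Parity and all range conditions together say that r, s, t, u are natural
    numbers. *)
Lemma gamma_coefE a i j k r s t u :
  i = (r + s)%N -> j = (s + t)%N -> k = (r + t)%N -> N = (r + s + t + u)%N ->
  gamma_coef N a i j k =
  (-1) ^+ k * (a + N%:R) * (a + N%:R - k%:R) *
  (N`!%:R / (r`!%:R * s`!%:R * t`!%:R * u`!%:R)) *
  (Gamma (a + s%:R) * Gamma (a + u%:R) /
   (Gamma a * Gamma (a + N%:R + 1 - t%:R) * Gamma (a + N%:R + 1 - r%:R))).
Proof.
move=> iE jE kE NE; rewrite /gamma_coef.
have -> : odd (i + j) == odd k by apply/eqP; rewrite iE jE kE; lia.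
rewrite (@binz_half r); last by rewrite iE jE kE; lia.
rewrite (@binz_half s); last by rewrite iE jE kE; lia.
have [NR iR jR kR] : [/\ N%:R = r%:R + s%:R + t%:R + u%:R :> R, i%:R = r%:R + s%:R :> R,
    j%:R = s%:R + t%:R :> R & k%:R = r%:R + t%:R :> R].
  by rewrite NE iE jE kE !natrD.
have -> : a - (k%:R - i%:R - j%:R) / 2 = a + s%:R by rewrite iR jR kR; field.
have -> : a + N%:R - (k%:R + i%:R + j%:R) / 2 = a + u%:R.
  by rewrite NR iR jR kR; field.
have -> : a + N%:R + 1 - (k%:R - i%:R + j%:R) / 2 = a + N%:R + 1 - t%:R.
  by rewrite iR jR kR; field.
have -> : a + N%:R + 1 - (k%:R + i%:R - j%:R) / 2 = a + N%:R + 1 - r%:R.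
  by rewrite iR jR kR; field.
congr (_ * _); rewrite -!mulrA; congr (_ * (_ * (_ * _))).
have b1 : 'C(N, k)%:R * (k`!%:R * (N - k)`!%:R) = N`!%:R :> R.
  by rewrite -!natrM bin_fact// NE kE; lia.
have b2 : 'C(k, r)%:R * (r`!%:R * t`!%:R) = k`!%:R :> R.
  have tE : t = (k - r)%N by lia.
  by rewrite [in LHS]tE -!natrM bin_fact//; lia.
have b3 : 'C(N - k, s)%:R * (s`!%:R * u`!%:R) = (N - k)`!%:R :> R.
  have uE : u = (N - k - s)%N by lia.
  by rewrite [in LHS]uE -!natrM bin_fact//; lia.
rewrite -b1 -b2 -b3; field.
by rewrite !natr_fact_neq0.
Qed.

Lemma gamma_coef_neq0 a i j k : gamma_coef N a i j k != 0 ->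
  exists r s t u : nat,
    [/\ i = (r + s)%N, j = (s + t)%N, k = (r + t)%N & N = (r + s + t + u)%N].
Proof.
rewrite /gamma_coef; case: ifP => [/eqP par|_]; last by rewrite eqxx.
have [kN|kN] := leqP k N; last by rewrite (bin_small kN) mulr0 !mul0r eqxx.
case rE: ((k%:Z + i%:Z - j%:Z) %/ 2)%Z => [r|r]; last by rewrite /= mulr0 !mul0r eqxx.
case sE: ((i%:Z + j%:Z - k%:Z) %/ 2)%Z => [s|s]; last by rewrite /= mulr0 !mul0r eqxx.
rewrite /=.
have [rk|rk] := leqP r k; last by rewrite (bin_small rk) mulr0 !mul0r eqxx.
have [sk|sk] := leqP s (N - k); last by rewrite (bin_small sk) mulr0 !mul0r eqxx.
move=> _; exists r, s, (k - r)%N, (N - k - s)%N.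
by split; lia.
Qed.

Lemma gamma_coef_eq0 a i j k : (forall r s t u : nat, i = (r + s)%N -> j = (s + t)%N ->
  k = (r + t)%N -> N = (r + s + t + u)%N -> False) -> gamma_coef N a i j k = 0.
Proof.
move=> h; apply/eqP/negPn/negP => /gamma_coef_neq0 [r [s [t [u [? ? ? ?]]]]].
exact: (h r s t u).
Qed.

End gamma_coefficients.

(** * Neighbouring coefficients gamma as rational multiples of a common factor *)

Section gamma_coefficient_shifts.
Variables (R : realType) (N : nat) (a : R) (i j k r s t u : nat).
Hypotheses (a_gt0 : 0 < a).
(* The indices of gamma_coef N a i j k are (r, s - 1, t, u - 1); the shift by
   one keeps all six terms of the recurrence in the range of nat. *)
Hypotheses (iE : i.+1 = (r + s)%N) (jE : j.+1 = (s + t)%N) (kE : k = (r + t)%N).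
Hypothesis NE : N.+2 = (r + s + t + u)%N.
Hypotheses (iN : (i <= N)%N) (jN : (j <= N)%N).
Hypotheses (s_gt0 : 0 < a + s%:R - 1) (u_gt0 : 0 < a + u%:R - 1).

(** The Gamma and factorial part shared by the six coefficients of the recurrence. When one of them
    is out of range, its rational cofactor contains the index among r, s, t, u that is 0, so the
    formulas hold without exception. *)
Definition gamma_base : R :=
  (-1) ^+ k * (N`!%:R / (r`!%:R * s`!%:R * t`!%:R * u`!%:R)) *
  (Gamma (a + s%:R - 1) * Gamma (a + u%:R - 1) /
   (Gamma a * Gamma (a + N%:R + 1 - t%:R) * Gamma (a + N%:R + 1 - r%:R))).

Let v_gt0 : 0 < a + N%:R + 1 - r%:R.
Proof.
have : r%:R <= N%:R + 1 :> R by rewrite natr1 ler_nat; lia.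
by move: a_gt0 => ? ?; lra.
Qed.

Let w_gt0 : 0 < a + N%:R + 1 - t%:R.
Proof.
have : t%:R <= N%:R + 1 :> R by rewrite natr1 ler_nat; lia.
by move: a_gt0 => ? ?; lra.
Qed.

Let neq0 (x : R) : 0 < x -> x != 0.
Proof. by move=> x0; rewrite gt_eqF. Qed.

Let gammaS (x y : R) : 0 < x -> y = x + 1 -> Gamma y = x * Gamma x.
Proof. by move=> x0 ->; rewrite Gamma_succ. Qed.

Let neq0s := (@natr_fact_neq0 R, @natr1_neq0 R, neq0 v_gt0, neq0 w_gt0, neq0 s_gt0, neq0 u_gt0,
  neq0 a_gt0).

Let Gamma_neq0 (x : R) : 0 < x -> Gamma x != 0.
Proof. by move=> x0; rewrite gt_eqF// Gamma_gt0. Qed.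

Lemma gamma_coef_shift1 :
  gamma_coef N a i j k =
  gamma_base * ((a + N%:R - k%:R) * (a + N%:R) * s%:R * u%:R).
Proof.
have [s0|s0] := posnP s.
  by rewrite gamma_coef_eq0 ?s0; [ring | move=> *; lia].
have [u0|u0] := posnP u.
  by rewrite gamma_coef_eq0 ?u0; [ring | move=> *; lia].
rewrite (@gamma_coefE _ _ a i j k r s.-1 t u.-1); [|lia..].
rewrite /gamma_base.
have -> : a + s.-1%:R = a + s%:R - 1 by rewrite -[in RHS](prednK s0) -natr1; ring.
have -> : a + u.-1%:R = a + u%:R - 1 by rewrite -[in RHS](prednK u0) -natr1; ring.
have -> : s`!%:R = s%:R * s.-1`!%:R :> R by rewrite -natrM -[in LHS](prednK s0) factS prednK.
have -> : u`!%:R = u%:R * u.-1`!%:R :> R by rewrite -natrM -[in LHS](prednK u0) factS prednK.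
have s0R : s%:R != 0 :> R by rewrite pnatr_eq0 -lt0n.
have u0R : u%:R != 0 :> R by rewrite pnatr_eq0 -lt0n.
have [g1 g2 g3] := And3 (Gamma_neq0 v_gt0) (Gamma_neq0 w_gt0) (Gamma_neq0 a_gt0).
move: (@Gamma R) g1 g2 g3 => g g1 g2 g3.
by field; rewrite !neq0s s0R u0R g1 g2 g3.
Qed.

Lemma gamma_coef_shift2 : (1 < k)%N ->
  gamma_coef N a i j k.-2 =
  gamma_base * ((a + N%:R - k%:R + 2) * (a + N%:R) * r%:R * t%:R *
    (a + s%:R - 1) * (a + u%:R - 1) /
    ((a + N%:R + 1 - r%:R) * (a + N%:R + 1 - t%:R))).
Proof.
move=> k1; have [r0|r0] := posnP r.
  by rewrite gamma_coef_eq0 ?r0; [ring | move=> *; lia].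
have [t0|t0] := posnP t.
  by rewrite gamma_coef_eq0 ?t0; [ring | move=> *; lia].
rewrite (@gamma_coefE _ _ a i j k.-2 r.-1 s t.-1 u); [|lia..].
rewrite /gamma_base.
have kS : k = k.-2.+2 by lia.
have -> : k.-2%:R = k%:R - 2 :> R by rewrite [in RHS]kS -!natr1; ring.
have -> : (-1) ^+ k = (-1) ^+ k.-2 :> R by rewrite [in LHS]kS !exprS; ring.
rewrite (gammaS (y := a + s%:R) s_gt0); last by ring.
rewrite (gammaS (y := a + u%:R) u_gt0); last by ring.
rewrite (gammaS (y := a + N%:R + 1 - t.-1%:R) w_gt0); last first.
  by rewrite -[in RHS](prednK t0) -natr1; ring.
rewrite (gammaS (y := a + N%:R + 1 - r.-1%:R) v_gt0); last first.
  by rewrite -[in RHS](prednK r0) -natr1; ring.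
have -> : r`!%:R = r%:R * r.-1`!%:R :> R by rewrite -natrM -[in LHS](prednK r0) factS prednK.
have -> : t`!%:R = t%:R * t.-1`!%:R :> R by rewrite -natrM -[in LHS](prednK t0) factS prednK.
have r0R : r%:R != 0 :> R by rewrite pnatr_eq0 -lt0n.
have t0R : t%:R != 0 :> R by rewrite pnatr_eq0 -lt0n.
have [g1 g2 g3] := And3 (Gamma_neq0 v_gt0) (Gamma_neq0 w_gt0) (Gamma_neq0 a_gt0).
move: (@Gamma R) g1 g2 g3 => g g1 g2 g3.
by field; rewrite !neq0s r0R t0R g1 g2 g3.
Qed.

Lemma gamma_coef_shift3 :
  gamma_coef N (a + 1) i j k =
  gamma_base * ((a + N%:R + 1 - k%:R) * (a + N%:R + 1) * s%:R * u%:R *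
    (a + s%:R - 1) * (a + u%:R - 1) /
    (a * (a + N%:R + 1 - r%:R) * (a + N%:R + 1 - t%:R))).
Proof.
have [s0|s0] := posnP s.
  by rewrite gamma_coef_eq0 ?s0; [ring | move=> *; lia].
have [u0|u0] := posnP u.
  by rewrite gamma_coef_eq0 ?u0; [ring | move=> *; lia].
rewrite (@gamma_coefE _ _ (a + 1) i j k r s.-1 t u.-1); [|lia..].
rewrite /gamma_base.
rewrite (gammaS (y := a + 1 + s.-1%:R) s_gt0); last first.
  by rewrite -[in RHS](prednK s0) -natr1; ring.
rewrite (gammaS (y := a + 1 + u.-1%:R) u_gt0); last first.
  by rewrite -[in RHS](prednK u0) -natr1; ring.
rewrite (gammaS (y := a + 1 + N%:R + 1 - t%:R) w_gt0); last by ring.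
rewrite (gammaS (y := a + 1 + N%:R + 1 - r%:R) v_gt0); last by ring.
rewrite (Gamma_succ a_gt0).
have -> : s`!%:R = s%:R * s.-1`!%:R :> R by rewrite -natrM -[in LHS](prednK s0) factS prednK.
have -> : u`!%:R = u%:R * u.-1`!%:R :> R by rewrite -natrM -[in LHS](prednK u0) factS prednK.
have s0R : s%:R != 0 :> R by rewrite pnatr_eq0 -lt0n.
have u0R : u%:R != 0 :> R by rewrite pnatr_eq0 -lt0n.
have [g1 g2 g3] := And3 (Gamma_neq0 v_gt0) (Gamma_neq0 w_gt0) (Gamma_neq0 a_gt0).
move: (@Gamma R) g1 g2 g3 => g g1 g2 g3.
by field; rewrite !neq0s s0R u0R g1 g2 g3.
Qed.

Lemma gamma_coef_shift4 : (0 < i)%N -> (0 < k)%N ->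
  gamma_coef N a i.-1 j k.-1 =
  - gamma_base * ((a + N%:R - k%:R + 1) * (a + N%:R) * r%:R * s%:R *
    (a + u%:R - 1) / (a + N%:R + 1 - r%:R)).
Proof.
move=> i0 k0; have [s0|s0] := posnP s.
  by rewrite gamma_coef_eq0 ?s0; [ring | move=> *; lia].
have [r0|r0] := posnP r.
  by rewrite gamma_coef_eq0 ?r0; [ring | move=> *; lia].
rewrite (@gamma_coefE _ _ a i.-1 j k.-1 r.-1 s.-1 t u); [|lia..].
rewrite /gamma_base.
have -> : k.-1%:R = k%:R - 1 :> R by rewrite -[in RHS](prednK k0) -natr1; ring.
have -> : (-1) ^+ k = - (-1) ^+ k.-1 :> R by rewrite -[in LHS](prednK k0) exprS mulN1r.
have -> : a + s.-1%:R = a + s%:R - 1 by rewrite -[in RHS](prednK s0) -natr1; ring.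
rewrite (gammaS (y := a + u%:R) u_gt0); last by ring.
rewrite (gammaS (y := a + N%:R + 1 - r.-1%:R) v_gt0); last first.
  by rewrite -[in RHS](prednK r0) -natr1; ring.
have -> : r`!%:R = r%:R * r.-1`!%:R :> R by rewrite -natrM -[in LHS](prednK r0) factS prednK.
have -> : s`!%:R = s%:R * s.-1`!%:R :> R by rewrite -natrM -[in LHS](prednK s0) factS prednK.
have r0R : r%:R != 0 :> R by rewrite pnatr_eq0 -lt0n.
have s0R : s%:R != 0 :> R by rewrite pnatr_eq0 -lt0n.
have [g1 g2 g3] := And3 (Gamma_neq0 v_gt0) (Gamma_neq0 w_gt0) (Gamma_neq0 a_gt0).
move: (@Gamma R) g1 g2 g3 => g g1 g2 g3.
by field; rewrite !neq0s r0R s0R g1 g2 g3.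
Qed.

Lemma gamma_coef_shift5 : (0 < k)%N ->
  gamma_coef N a i.+1 j k.-1 =
  - gamma_base * ((a + N%:R - k%:R + 1) * (a + N%:R) * t%:R * u%:R *
    (a + s%:R - 1) / (a + N%:R + 1 - t%:R)).
Proof.
move=> k0; have [u0|u0] := posnP u.
  by rewrite gamma_coef_eq0 ?u0; [ring | move=> *; lia].
have [t0|t0] := posnP t.
  by rewrite gamma_coef_eq0 ?t0; [ring | move=> *; lia].
rewrite (@gamma_coefE _ _ a i.+1 j k.-1 r s t.-1 u.-1); [|lia..].
rewrite /gamma_base.
have -> : k.-1%:R = k%:R - 1 :> R by rewrite -[in RHS](prednK k0) -natr1; ring.
have -> : (-1) ^+ k = - (-1) ^+ k.-1 :> R by rewrite -[in LHS](prednK k0) exprS mulN1r.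
have -> : a + u.-1%:R = a + u%:R - 1 by rewrite -[in RHS](prednK u0) -natr1; ring.
rewrite (gammaS (y := a + s%:R) s_gt0); last by ring.
rewrite (gammaS (y := a + N%:R + 1 - t.-1%:R) w_gt0); last first.
  by rewrite -[in RHS](prednK t0) -natr1; ring.
have -> : t`!%:R = t%:R * t.-1`!%:R :> R by rewrite -natrM -[in LHS](prednK t0) factS prednK.
have -> : u`!%:R = u%:R * u.-1`!%:R :> R by rewrite -natrM -[in LHS](prednK u0) factS prednK.
have t0R : t%:R != 0 :> R by rewrite pnatr_eq0 -lt0n.
have u0R : u%:R != 0 :> R by rewrite pnatr_eq0 -lt0n.
have [g1 g2 g3] := And3 (Gamma_neq0 v_gt0) (Gamma_neq0 w_gt0) (Gamma_neq0 a_gt0).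
move: (@Gamma R) g1 g2 g3 => g g1 g2 g3.
by field; rewrite !neq0s t0R u0R g1 g2 g3.
Qed.

Lemma gamma_coef_shift6 : (1 < k)%N -> 0 < a - 1 ->
  gamma_coef N (a - 1) i j k.-2 =
  gamma_base * ((a + N%:R - k%:R + 1) * (a + N%:R - 1) * r%:R * t%:R * (a - 1)).
Proof.
move=> k1 a1; have [r0|r0] := posnP r.
  by rewrite gamma_coef_eq0 ?r0; [ring | move=> *; lia].
have [t0|t0] := posnP t.
  by rewrite gamma_coef_eq0 ?t0; [ring | move=> *; lia].
rewrite (@gamma_coefE _ _ (a - 1) i j k.-2 r.-1 s t.-1 u); [|lia..].
rewrite /gamma_base.
have kS : k = k.-2.+2 by lia.
have -> : k.-2%:R = k%:R - 2 :> R by rewrite [in RHS]kS -!natr1; ring.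
have -> : (-1) ^+ k = (-1) ^+ k.-2 :> R by rewrite [in LHS]kS !exprS; ring.
have -> : a - 1 + s%:R = a + s%:R - 1 by ring.
have -> : a - 1 + u%:R = a + u%:R - 1 by ring.
have -> : a - 1 + N%:R + 1 - t.-1%:R = a + N%:R + 1 - t%:R.
  by rewrite -[in RHS](prednK t0) -natr1; ring.
have -> : a - 1 + N%:R + 1 - r.-1%:R = a + N%:R + 1 - r%:R.
  by rewrite -[in RHS](prednK r0) -natr1; ring.
rewrite (gammaS (y := a) a1); last by ring.
have -> : r`!%:R = r%:R * r.-1`!%:R :> R by rewrite -natrM -[in LHS](prednK r0) factS prednK.
have -> : t`!%:R = t%:R * t.-1`!%:R :> R by rewrite -natrM -[in LHS](prednK t0) factS prednK.
have r0R : r%:R != 0 :> R by rewrite pnatr_eq0 -lt0n.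
have t0R : t%:R != 0 :> R by rewrite pnatr_eq0 -lt0n.
have [g1 g2 g3] := And3 (Gamma_neq0 v_gt0) (Gamma_neq0 w_gt0) (Gamma_neq0 a1).
move: (@Gamma R) g1 g2 g3 => g g1 g2 g3.
by field; rewrite !neq0s r0R t0R (neq0 a1) g1 g2 g3.
Qed.

End gamma_coefficient_shifts.

#[local] Opaque Gamma.

(** * The right-hand side as a polynomial: recurrence, derivative, leading coefficient *)

Section expansion.
Variables (R : realType) (N : nat).
Implicit Types (nu : R) (i j k n : nat).

Definition Fcoef nu k n i j : R :=
  n`!%:R * Gamma (nu + N%:R) / 2 ^+ n * gamma_coef N (nu + n%:R) i j k.

(** The value 0 at the bottom replaces the [f 0] that a truncated predecessor would produce. *)
Definition shift1 (T : nmodType) (f : nat -> T) k : T := if (0 < k)%N then f k.-1 else 0.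
Definition shift2 (T : nmodType) (f : nat -> T) k : T := if (1 < k)%N then f k.-2 else 0.

(** This compares coefficients of C_(n+1-k). On the left, the scalar recurrence sends X C_(n-k) to
    the indices k and k + 2, hence the two terms. After division by [gamma_base] it is rational in
    r, s, t, u, n and nu. *)
Lemma Fcoef_ttr nu n i j k : 0 < nu -> (i <= N)%N -> (j <= N)%N -> (k <= n.+1)%N ->
  let a := nu + n%:R in
  (a + i%:R) * (a + N%:R - i%:R) *
   (2^-1 * ((n.+1%:R - k%:R) * (Fcoef nu k n i j / (a + N%:R - k%:R)) +
    (n%:R - k%:R + 1 + 2 * (nu + N%:R)) *
     shift2 (fun k => Fcoef nu k n i j / (a + N%:R - k%:R)) k)) =
  a * (a + N%:R) * Fcoef nu k n.+1 i j +
  (N%:R - i%:R + 1) * (i%:R + nu - 1) / 2 *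
    shift1 (fun i => shift1 (fun k => Fcoef nu k n i j) k) i +
  (i%:R + 1) * (N%:R - i%:R + nu - 1) / 2 * shift1 (fun k => Fcoef nu k n i.+1 j) k +
  n%:R * (N%:R + a) * (N%:R + n%:R + 2 * nu - 1) / (4 * (a + N%:R - 1)) *
    shift2 (fun k => Fcoef nu k n.-1 i j) k.
Proof.
move=> nu0 iN jN kn a.
have a0 : 0 < a by rewrite ltr_wpDr.
(* The shifted quadruple covers the supports of all six coefficients at once; if there is none,
   every term is 0. *)
have [[r [s [t [u [iE jE kE NE]]]]]|nex] := pselect (exists r s t u : nat,
   [/\ i.+1 = (r + s)%N, j.+1 = (s + t)%N, k = (r + t)%N & N.+2 = (r + s + t + u)%N]);
  last first.
  have z (b : R) k' : (k' = k \/ k' = k.-2 /\ 1 < k)%N -> gamma_coef N b i j k' = 0.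
    move=> kk; apply: gamma_coef_eq0 => r s t u e1 e2 e3 e4; apply: nex.
    case: kk => [kk|[kk k1]].
      by exists r, s.+1, t, u.+1; split; lia.
    by exists r.+1, s, t.+1, u; split; lia.
  have z2 : shift2 (fun k => Fcoef nu k n i j / (a + N%:R - k%:R)) k = 0.
    rewrite /shift2; case: ifP => [k1|]; last by [].
    by rewrite /Fcoef z ?mulr0 ?mul0r//; right.
  have z3 : shift2 (fun k => Fcoef nu k n.-1 i j) k = 0.
    rewrite /shift2; case: ifP => [k1|]; last by [].
    by rewrite /Fcoef z ?mulr0//; right.
  have z4 : shift1 (fun i => shift1 (fun k => Fcoef nu k n i j) k) i = 0.
    rewrite /shift1; case: ifP => [i0|]; last by [].
    case: ifP => [k0|]; last by [].
    rewrite /Fcoef gamma_coef_eq0 ?mulr0// => r s t u e1 e2 e3 e4; apply: nex.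
    by exists r.+1, s.+1, t, u; split; lia.
  have z5 : shift1 (fun k => Fcoef nu k n i.+1 j) k = 0.
    rewrite /shift1; case: ifP => [k0|]; last by [].
    rewrite /Fcoef gamma_coef_eq0 ?mulr0// => r s t u e1 e2 e3 e4; apply: nex.
    by exists r, s, t.+1, u.+1; split; lia.
  have z6 m : Fcoef nu k m i j = 0 by rewrite /Fcoef z ?mulr0//; left.
  by rewrite z2 z3 z4 z5 !z6 !mul0r !mulr0 !addr0 !mulr0.
(* It suffices that n + s and n + u are positive. If n = s = 0, then r = i + 1 and t = j + 1, so k =
   r + t would exceed n + 1; the case n = u = 0 contradicts the bounds on i, j and k likewise. *)
have [s0 u0] : 0 < a + s%:R - 1 /\ 0 < a + u%:R - 1.
  have pos m : (0 < n + m)%N -> 0 < a + m%:R - 1.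
    move=> nm; have : 1 <= n%:R + m%:R :> R by rewrite -natrD ler1n.
    by rewrite /a => ?; move: nu0 => ?; lra.
  by split; apply: pos; lia.
have [NR iR kR] : [/\ N%:R = r%:R + s%:R + t%:R + u%:R - 2 :> R, i%:R = r%:R + s%:R - 1 :> R
    & k%:R = r%:R + t%:R :> R].
  split.
  - by rewrite -!natrD -NE -!natr1; ring.
  - by rewrite -natrD -iE -natr1; ring.
  - by rewrite kE natrD.
have vw0 (m : nat) : (m <= N.+1)%N -> 0 < a + N%:R + 1 - m%:R.
  by move=> mN; have : m%:R <= N%:R + 1 :> R; [rewrite natr1 ler_nat | move: a0 => ? ?; lra].
have v0 : 0 < a + N%:R + 1 - r%:R by apply: vw0; lia.
have w0 : 0 < a + N%:R + 1 - t%:R by apply: vw0; lia.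
have an1 : (0 < n)%N -> 0 < a - 1.
  by move=> n0; rewrite /a -(prednK n0) -natr1; move: nu0 (ler0n R n.-1) => ? ?; lra.
have aN1 : (0 < n)%N -> a + N%:R - 1 != 0.
  by move=> /an1 a1; rewrite gt_eqF//; move: a1 (ler0n R N) => ? ?; lra.
set B := gamma_base N a k r s t u.
set c := n`!%:R * Gamma (nu + N%:R) / 2 ^+ n.
have T1 : (n.+1%:R - k%:R) * (Fcoef nu k n i j / (a + N%:R - k%:R)) =
    (n.+1%:R - k%:R) * (c * B * ((a + N%:R) * s%:R * u%:R)).
  (* At k = n + 1 the denominator is nu + N - 1, which may vanish; the factor n + 1 - k is then
     0. *)
  have [->|kn'] := eqVneq k n.+1; first by rewrite subrr !mul0r.
  rewrite /Fcoef -/a (gamma_coef_shift1 a0 iE jE kE NE iN jN s0 u0) -/c -/B.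
  have ak0 : a + N%:R - k%:R != 0.
    rewrite gt_eqF// /a; have : k%:R <= n%:R :> R by rewrite ler_nat; lia.
    by have : 0 <= N%:R :> R by []; move: nu0 => ? ? ?; lra.
  by field.
have T2 : shift2 (fun k => Fcoef nu k n i j / (a + N%:R - k%:R)) k =
    c * B * ((a + N%:R) * r%:R * t%:R * (a + s%:R - 1) * (a + u%:R - 1) /
    ((a + N%:R + 1 - r%:R) * (a + N%:R + 1 - t%:R))).
  rewrite /shift2; case: ltnP => [k1|k1]; last first.
    by have [->|->] : r = 0%N \/ t = 0%N by [lia | |]; rewrite !(mulr0, mul0r).
  rewrite /Fcoef -/a (gamma_coef_shift2 a0 iE jE kE NE iN jN s0 u0)// -/c -/B.
  have -> : k.-2%:R = k%:R - 2 :> R.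
    by rewrite -[in RHS](subnK k1) natrD subn2; ring.
  have ak0 : a + N%:R - (k%:R - 2) != 0.
    rewrite gt_eqF// /a; have : k%:R <= n%:R + 1 :> R by rewrite natr1 ler_nat.
    by have : 0 <= N%:R :> R by []; move: nu0 => ? ? ?; lra.
  by field; rewrite ak0 !gt_eqF.
have a1E : nu + n.+1%:R = a + 1 by rewrite /a -natr1 addrA.
have T3 : Fcoef nu k n.+1 i j = c * B * ((n%:R + 1) / 2 *
    ((a + N%:R + 1 - k%:R) * (a + N%:R + 1) * s%:R * u%:R *
    (a + s%:R - 1) * (a + u%:R - 1) /
    (a * (a + N%:R + 1 - r%:R) * (a + N%:R + 1 - t%:R)))).
  rewrite /Fcoef a1E (gamma_coef_shift3 a0 iE jE kE NE iN jN s0 u0) -/B /c.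
  rewrite factS natrM -[n.+1%:R]natr1 exprS.
  have e0 : 2 ^+ n != 0 :> R by rewrite expf_neq0.
  by move: (Gamma _) => g; field; rewrite e0 !gt_eqF.
have T4 : shift1 (fun i => shift1 (fun k => Fcoef nu k n i j) k) i = - (c * B) *
    ((a + N%:R - k%:R + 1) * (a + N%:R) * r%:R * s%:R *
    (a + u%:R - 1) / (a + N%:R + 1 - r%:R)).
  rewrite /shift1; case: ltnP => [i0|i0]; last first.
    by have [->|->] : r = 0%N \/ s = 0%N by [lia | | ]; ring.
  case: ltnP => [k0|k0]; last first.
    by have -> : r = 0%N by [lia|]; ring.
  rewrite /Fcoef -/a (gamma_coef_shift4 a0 iE jE kE NE iN jN s0 u0)// -/c -/B.
  by ring.
have T5 : shift1 (fun k => Fcoef nu k n i.+1 j) k = - (c * B) *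
    ((a + N%:R - k%:R + 1) * (a + N%:R) * t%:R * u%:R *
    (a + s%:R - 1) / (a + N%:R + 1 - t%:R)).
  rewrite /shift1; case: ltnP => [k0|k0]; last first.
    by have -> : t = 0%N by [lia|]; ring.
  rewrite /Fcoef -/a (gamma_coef_shift5 a0 iE jE kE NE iN jN s0 u0)// -/c -/B.
  by ring.
have T6 : n%:R * (N%:R + a) * (N%:R + n%:R + 2 * nu - 1) / (4 * (a + N%:R - 1)) *
    shift2 (fun k => Fcoef nu k n.-1 i j) k =
    c * B * ((N%:R + a) * (N%:R + n%:R + 2 * nu - 1) / 2 *
    ((a + N%:R - k%:R + 1) * r%:R * t%:R * (a - 1))).
  rewrite /shift2; case: ltnP => [k1|k1]; last first.
    by have [->|->] : r = 0%N \/ t = 0%N by [lia | | ]; ring.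
  have n0 : (0 < n)%N by lia.
  have a10 := an1 n0.
  have aE : nu + n.-1%:R = a - 1 by rewrite /a -[in RHS](prednK n0) -natr1; ring.
  rewrite /Fcoef aE (gamma_coef_shift6 a0 iE jE kE NE iN jN s0 u0)// -/B /c.
  rewrite -[in n`!](prednK n0) factS prednK// natrM -[in 2 ^+ n](prednK n0) exprS.
  have e0 : 2 ^+ n.-1 != 0 :> R by rewrite expf_neq0.
  have aN := aN1 n0.
  by move: (Gamma _) => g; field; rewrite e0 aN.
rewrite T1 T2 T3 T4 T5 T6 NR iR kR.
have nE : nu = a - n%:R by rewrite /a; ring.
rewrite NR in v0 w0; rewrite -natr1 nE.
move: (c * B) => cB; clearbody a.
by field; rewrite !gt_eqF.
Qed.

Notation Cg nu := (gegenbauer (nu + N%:R)).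

(* Entry (i, j) of the right-hand side of the theorem, as a polynomial; the terms
   with N < k <= n vanish. *)
Definition expansion nu n i j : {poly R} :=
  \sum_(k < n.+1) Fcoef nu k n i j *: Cg nu (n - k).

Lemma sum_shift1 nu (f : nat -> R) n :
  \sum_(k < n.+1) f k *: Cg nu (n - k) =
  \sum_(k < n.+2) shift1 f k *: Cg nu (n.+1 - k).
Proof.
rewrite [RHS]big_ord_recl /= scale0r add0r.
by apply: eq_bigr => k _; rewrite /bump /= add1n subSS.
Qed.

Lemma sum_shift2 nu (f : nat -> R) n :
  \sum_(k < n) f k *: Cg nu (n.-1 - k) =
  \sum_(k < n.+2) shift2 f k *: Cg nu (n.+1 - k).
Proof.
rewrite [RHS]big_ord_recl /= scale0r add0r [RHS]big_ord_recl /= scale0r add0r.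
apply: eq_bigr => k _; rewrite /bump /= !add1n /shift2 /=; congr (_ *: Cg nu _).
by lia.
Qed.

Lemma expansionX nu n i j : 0 < nu ->
  'X * expansion nu n i j = \sum_(k < n.+2)
   (2^-1 * ((n.+1%:R - k%:R) * (Fcoef nu k n i j / (nu + n%:R + N%:R - k%:R)) +
    (n%:R - k%:R + 1 + 2 * (nu + N%:R)) *
     shift2 (fun k => Fcoef nu k n i j / (nu + n%:R + N%:R - k%:R)) k)) *: Cg nu (n.+1 - k).
Proof.
move=> nu0; have lam0 : 0 < nu + N%:R by rewrite ltr_wpDr.
pose f k := Fcoef nu k n i j / (nu + n%:R + N%:R - k%:R).
(* After the shift, [g] is taken at k - 2, where its n - k - 1 becomes the n - k + 1 of the
   statement. *)
pose g k := (n%:R - k%:R - 1 + 2 * (nu + N%:R)) * f k.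
transitivity (2^-1 *: (\sum_(k < n.+2) ((n.+1%:R - k%:R) * f k) *: Cg nu (n.+1 - k) +
    \sum_(k < n.+2) shift2 g k *: Cg nu (n.+1 - k))); last first.
  rewrite -big_split scaler_sumr; apply: eq_bigr => k _ /=.
  rewrite -scalerDl scalerA; congr (_ *: _); congr (_ * (_ + _)).
  rewrite /shift2; case: ltnP => [k1|_]; last by rewrite mulr0.
  rewrite /g; congr (_ * _).
  by rewrite -[in RHS](subnK k1) natrD subn2; ring.
rewrite -sum_shift2 [X in _ *: (X + _)]big_ord_recr /= subrr mul0r scale0r addr0.
have -> : \sum_(k < n) g k *: Cg nu (n.-1 - k) =
    \sum_(k < n.+1) g k *: gegenbauer_pred (nu + N%:R) (n - k).
  rewrite [RHS]big_ord_recr /= subnn scaler0 addr0; apply: eq_bigr => k _.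
  have -> : (n - k = (n.-1 - k).+1)%N by have := ltn_ord k; lia.
  by [].
rewrite -big_split scaler_sumr /expansion mulr_sumr; apply: eq_bigr => k _ /=.
have kn : (k <= n)%N by rewrite -ltnS.
have nkE : nu + n%:R + N%:R - k%:R = (n - k)%:R + (nu + N%:R).
  by rewrite natrB//; ring.
have nk0 : (n - k)%:R + (nu + N%:R) != 0 by rewrite gt_eqF// ltr_wpDl.
rewrite -scalerAr; apply: (scalerI nk0); rewrite [LHS]scalerA [in LHS]mulrC -[LHS]scalerA.
rewrite gegenbauer_ttr// !(scalerA, scalerDr) -subSn//.
congr (_ *: _ + _ *: _).
  by rewrite /f nkE natrB ?leqW//; field.
have -> : g k = (n%:R - k%:R - 1 + 2 * (nu + N%:R)) *
    (Fcoef nu k n i j / ((n - k)%:R + (nu + N%:R))).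
  by rewrite /g /f nkE.
have -> : n%:R - k%:R = (n - k)%:R :> R by rewrite natrB.
by move: (Fcoef _ _ _ _ _) => F; field; rewrite nk0.
Qed.

(** No coefficient depends on j: this is a matrix identity with factors on the left of Q_n, so it
    survives multiplication by W on the right and integration. *)
Lemma expansion_ttr nu n i j : 0 < nu -> (i <= N)%N -> (j <= N)%N ->
  let a := nu + n%:R in
  ((a + i%:R) * (a + N%:R - i%:R)) *: ('X * expansion nu n i j) =
  (a * (a + N%:R)) *: expansion nu n.+1 i j +
  ((N%:R - i%:R + 1) * (i%:R + nu - 1) / 2) *:
    shift1 (fun i => expansion nu n i j) i +
  ((i%:R + 1) * (N%:R - i%:R + nu - 1) / 2) *: expansion nu n i.+1 j +
  (n%:R * (N%:R + a) * (N%:R + n%:R + 2 * nu - 1) / (4 * (a + N%:R - 1))) *: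
    expansion nu n.-1 i j.
Proof.
move=> nu0 iN jN a.
have -> : shift1 (fun i => expansion nu n i j) i = \sum_(k < n.+2)
    shift1 (fun i => shift1 (fun k => Fcoef nu k n i j) k) i *: Cg nu (n.+1 - k).
  rewrite /shift1; case: ltnP => [i0|i0]; last by rewrite big1// => k _; rewrite scale0r.
  exact: (sum_shift1 nu (fun k => Fcoef nu k n i.-1 j) n).
have -> : (n%:R * (N%:R + a) * (N%:R + n%:R + 2 * nu - 1) / (4 * (a + N%:R - 1))) *:
    expansion nu n.-1 i j = \sum_(k < n.+2)
    (n%:R * (N%:R + a) * (N%:R + n%:R + 2 * nu - 1) / (4 * (a + N%:R - 1))) *:
     (shift2 (fun k => Fcoef nu k n.-1 i j) k *: Cg nu (n.+1 - k)).
  rewrite -scaler_sumr -sum_shift2; case: n @a => [|m] a; last by [].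
  by rewrite !mul0r !scale0r.
rewrite [expansion nu n i.+1 j](sum_shift1 nu (fun k => Fcoef nu k n i.+1 j) n).
rewrite (expansionX _ _ _ nu0) !scaler_sumr.
rewrite -!big_split; apply: eq_bigr => k _; rewrite /= !scalerA -!scalerDl.
congr (_ *: _); apply: Fcoef_ttr => //.
by rewrite -ltnS.
Qed.

(** Passing from (nu, n) to (nu + 1, n - 1) leaves nu + n, hence [gamma_coef], unchanged, and the
    ratio of the prefactors is n / (2 (nu + N)). The derivative of C^(nu+N) supplies 2 (nu + N). *)
Lemma deriv_expansion nu n i j : 0 < nu ->
  (expansion nu n i j)^`() = n%:R *: (if n is n'.+1 then expansion (nu + 1) n' i j else 0).
Proof.
move=> nu0; have lam0 : 0 < nu + N%:R by rewrite ltr_wpDr.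
rewrite /expansion deriv_sum; case: n => [|n].
  rewrite big_ord_recl big_ord0 subn0 (gegenbauer0 lam0) scale0r addr0.
  by rewrite derivZ derivC scaler0.
rewrite [LHS]big_ord_recr /= subnn (gegenbauer0 lam0).
have -> : (Fcoef nu n.+1 n.+1 i j *: (1 : {poly R}))^`() = 0.
  by rewrite derivZ derivC scaler0.
rewrite addr0.
rewrite scaler_sumr; apply: eq_bigr => k _.
have kn : (n.+1 - k = (n - k).+1)%N by rewrite subSn// leq_ord.
have nE : nu + 1 + n%:R = nu + n.+1%:R by rewrite -natr1; ring.
have lE : nu + 1 + N%:R = nu + N%:R + 1 by rewrite addrAC.
have e0 : 2 ^+ n != 0 :> R by rewrite expf_neq0.
have E : Fcoef nu k n.+1 i j * (2 * (nu + N%:R)) = n.+1%:R * Fcoef (nu + 1) k n i j.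
  rewrite /Fcoef nE lE (Gamma_succ lam0) factS natrM exprS.
  by move: (Gamma _) (gamma_coef _ _ _ _ _) => g h; field; rewrite e0.
by rewrite derivZ kn (deriv_gegenbauer _ lam0) /= [LHS]scalerA E -lE -scalerA.
Qed.

(** For k = 0 the coordinates r and t are 0, so i = s = j. The factor in front of the entry of D_n
    is the inverse of the leading coefficient of C_n^(nu+N). *)
Lemma Fcoef_lead nu i : 0 < nu -> (i <= N)%N -> forall j, (j <= N)%N ->
  forall n, Fcoef nu 0 n i j =
    if i == j then n`!%:R / 2 ^+ n / pochhammer (nu + N%:R) n *
      ('C(N, i)%:R * (pochhammer (nu + n%:R) i / pochhammer (nu + n%:R + (N - i)%:R) i))
    else 0.
Proof.
move=> nu0 iN j jN n; have lam0 : 0 < nu + N%:R by rewrite ltr_wpDr.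
have a0 : 0 < nu + n%:R by rewrite ltr_wpDr.
have aN0 : 0 < nu + n%:R + (N - i)%:R by rewrite ltr_wpDr.
case: eqVneq => [<-|ij]; last first.
  rewrite /Fcoef gamma_coef_eq0 ?mulr0// => r s t u e1 e2 e3 e4.
  by case/eqP: ij; lia.
rewrite /Fcoef (@gamma_coefE _ _ _ i i 0 0 i 0 (N - i)); [|lia..].
rewrite (Gamma_pochhammer i a0).
have -> : nu + n%:R + N%:R + 1 - 0%:R = nu + N%:R + n%:R + 1 by ring.
rewrite Gamma_succ ?ltr_wpDr// (Gamma_pochhammer _ lam0).
(* Both sides are Gamma (nu + n + N), reached from two base points. *)
have E : pochhammer (nu + n%:R + (N - i)%:R) i * Gamma (nu + n%:R + (N - i)%:R) =
    pochhammer (nu + N%:R) n * Gamma (nu + N%:R).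
  rewrite -(Gamma_pochhammer _ aN0) -(Gamma_pochhammer _ lam0); congr Gamma.
  by rewrite natrB//; ring.
have C : 'C(N, i)%:R * (i`!%:R * (N - i)`!%:R) = N`!%:R :> R.
  by rewrite -!natrM bin_fact.
have p1 := pochhammer_gt0 i aN0.
have -> : Gamma (nu + n%:R + (N - i)%:R) =
  pochhammer (nu + N%:R) n * Gamma (nu + N%:R) / pochhammer (nu + n%:R + (N - i)%:R) i.
  by rewrite -E mulrAC divff ?mul1r// gt_eqF.
have p2 := pochhammer_gt0 n lam0.
have g1 := Gamma_gt0 a0; have g2 := Gamma_gt0 lam0.
have anN : 0 < nu + N%:R + n%:R by rewrite ltr_wpDr.
have e0 : 2 ^+ n != 0 :> R by rewrite expf_neq0.
have f0 := natr_fact_neq0 R.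
rewrite -C expr0 !fact0.
move: (Gamma (nu + n%:R)) (Gamma (nu + N%:R)) g1 g2 => g g' g1 g2.
move: (pochhammer _ n) (pochhammer (_ + (N - i)%:R) i) p1 p2 => p p' p1 p2.
by field; rewrite !f0 e0 !gt_eqF.
Qed.

End expansion.

(** * The coefficients alpha of the weight and their neighbours *)

Section weight_coefficients.
Variables (R : realType) (N : nat).
Implicit Types (nu : R) (i j k p q u : nat).

(* alpha_k(i,j), extended by 0 outside its range; in the coordinates
   p = i - k, q = j - k, u = N + k - i - j the range is p, q, k, u >= 0. *)
Definition walpha nu i j k : R :=
  if [&& (k <= i)%N, (k <= j)%N & (i + j <= N + k)%N] then alpha N nu k i j else 0.

Definition walphaf nu p q k u : R :=
  (-1) ^+ k *
  (((p + k)`!%:R * (q + k)`!%:R * (p + q)`!%:R) /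
   (k`!%:R * pochhammer (2 * nu) (p + q) * pochhammer nu (p + q + k))) *
  ((pochhammer nu p * pochhammer nu q) / (p`!%:R * q`!%:R)) *
  ((p%:R + q%:R + nu) / (p%:R + q%:R + k%:R + nu)) *
  (((u + q)`!%:R * (u + p)`!%:R) / u`!%:R) *
  pochhammer (- N%:R - nu) k * ((N%:R + nu) / N`!%:R).

Lemma walphaE nu i j k p q u :
  i = (p + k)%N -> j = (q + k)%N -> N = (p + q + k + u)%N ->
  walpha nu i j k = walphaf nu p q k u.
Proof.
move=> iE jE NE; rewrite /walpha ifT; last by lia.
rewrite /alpha /walphaf -!natrD.
have -> : (i + j - k.*2 = p + q)%N by lia.
have -> : (i + j - k = p + q + k)%N by lia.
have -> : (i - k = p)%N by lia.
have -> : (j - k = q)%N by lia.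
have -> : (N - i = u + q)%N by lia.
have -> : (N - j = u + p)%N by lia.
have -> : (N + k - (i + j) = u)%N by lia.
by rewrite iE jE.
Qed.

Lemma walpha_eq0 nu i j k : (forall p q u : nat, i = (p + k)%N -> j = (q + k)%N ->
  N = (p + q + k + u)%N -> False) -> walpha nu i j k = 0.
Proof.
move=> h; rewrite /walpha; case: ifP => [/and3P[ki kj ijN]|]; last by [].
by case: (h (i - k) (j - k) (N + k - (i + j)))%N; lia.
Qed.

Let poch_neq0 (x : R) m : 0 < x -> pochhammer x m != 0.
Proof. by move=> x0; rewrite gt_eqF// pochhammer_gt0. Qed.

Let poch_succ (x : R) m : 0 < x -> pochhammer (x + 1) m = pochhammer x m * (x + m%:R) / x.
Proof. by move=> x0; rewrite -pochhammerS pochhammerSl mulrAC divff ?mul1r ?gt_eqF. Qed.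

Section shifts.
Variables (nu : R) (p q k u : nat).
Hypotheses (nu_gt0 : 0 < nu) (NE : N = (p + q + k + u)%N).

Let poch_neg_neq0 m : (m <= N.+1)%N -> pochhammer (- N%:R - nu) m != 0.
Proof.
move=> mN; apply/prodf_neq0 => l _; rewrite lt_eqF//.
have : l%:R <= N%:R :> R by rewrite ler_nat; have := ltn_ord l; lia.
by move: nu_gt0 => ? ?; lra.
Qed.

Let n2 : 0 < 2 * nu.
Proof. by rewrite mulr_gt0. Qed.

Local Ltac generalize_fact t :=
  let f := fresh "f" in let f0 := fresh "f0" in
  have f0 := natr_fact_neq0 R t; move: (t`!%:R : R) f0 => f f0.

Local Ltac generalize_poch x0 m :=
  let f := fresh "w" in let f0 := fresh "w0" in
  have f0 := poch_neq0 m x0; move: (pochhammer _ m) f0 => f f0.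

Local Ltac generalize_poch_neg mN :=
  let f := fresh "w" in let f0 := fresh "w0" in
  have f0 := poch_neg_neq0 mN; move: (pochhammer (- N%:R - nu) _) f0 => f f0.

Local Ltac generalize_nat m :=
  let f := fresh "x" in let f0 := fresh "x0" in
  have f0 := ler0n R m; move: (m%:R : R) f0 => f f0.

Local Ltac nneg :=
  first [assumption | exact: ler01 | exact: ler0n | apply: addr_ge0; nneg
    | apply: mulr_ge0; nneg | apply: ltW; assumption].

Local Ltac pos :=
  first [assumption | exact: ltr01 | by rewrite ltr0n | apply: mulr_gt0; pos
    | apply: ltr_pwDl; [pos | nneg] | apply: ltr_wpDl; [nneg | pos]].

Local Ltac nonzero :=
  repeat (apply/andP; split); first [assumption | apply: lt0r_neq0; pos].

Let den_neq0 : - N%:R - nu + k%:R - 1 != 0.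
Proof.
rewrite lt_eqF//; have : k%:R <= N%:R :> R by rewrite ler_nat NE; lia.
by move: nu_gt0 => ? ?; lra.
Qed.

(** In terms of (i, j, k), with i and N fixed, this is the move to (j, k - 1). The next two lemmas
    are the moves to (j - 1, k - 1) and (j + 1, k); these are the neighbours met in the Pearson
    equation. *)
Lemma walphaf_shift_pq : (0 < k)%N -> (0 < u)%N ->
  walphaf nu p.+1 q.+1 k.-1 u.-1 = - walphaf nu p q k u *
  ((p%:R + q%:R + 1) * (p%:R + q%:R + 2) * k%:R * (nu + p%:R) * (nu + q%:R) *
   (p%:R + q%:R + 2 + nu) * u%:R /
   ((2 * nu + p%:R + q%:R) * (2 * nu + p%:R + q%:R + 1) *
    (p%:R + 1) * (q%:R + 1) *
    (p%:R + q%:R + k%:R + 1 + nu) * (p%:R + q%:R + nu) *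
    (- N%:R - nu + k%:R - 1))).
Proof.
move=> k0 u0; move: den_neq0; rewrite /walphaf.
have [k' kE] : exists k', k = k'.+1 by exists k.-1; lia.
have [u' uE] : exists u', u = u'.+1 by exists u.-1; lia.
have kN : (k' < N)%N by lia.
rewrite kE uE /=.
have -> : (p.+1 + k' = p + k'.+1)%N by lia.
have -> : (q.+1 + k' = q + k'.+1)%N by lia.
have -> : (u' + q.+1 = u'.+1 + q)%N by lia.
have -> : (u' + p.+1 = u'.+1 + p)%N by lia.
have -> : (p.+1 + q.+1 = (p + q).+2)%N by lia.
have -> : ((p + q).+2 + k' = (p + q + k').+2)%N by lia.
have -> : (p + q + k'.+1 = (p + q + k').+1)%N by lia.
generalize_fact (p + k'.+1)%N; generalize_fact (q + k'.+1)%N.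
generalize_fact (u'.+1 + q)%N; generalize_fact (u'.+1 + p)%N.
rewrite !pochhammerS !natr_factS exprS.
generalize_fact (p + q)%N; generalize_fact k'; generalize_fact u';
generalize_fact p; generalize_fact q.
generalize_poch n2 (p + q)%N; generalize_poch nu_gt0 (p + q + k')%N.
generalize_poch_neg (leqW (ltnW kN)).
generalize_poch nu_gt0 p; generalize_poch nu_gt0 q; generalize_fact N.
rewrite -!natr1 !natrD -?natr1.
generalize_nat p; generalize_nat q; generalize_nat k'; generalize_nat u'; generalize_nat N.
move=> d0.
field; nonzero.
Qed.

(** The factor q + k is j, the weight of this neighbour in the Pearson equation; it completes the
    factorial of j - 1. The factor u + p = N - j plays the same part for the move to j + 1. *)
Lemma walphaf_shift_p : (0 < k)%N ->
  (q%:R + k%:R) * walphaf nu p.+1 q k.-1 u = - walphaf nu p q k u *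
  ((p%:R + q%:R + 1) * k%:R * (nu + p%:R) * (u%:R + p%:R + 1) *
   (p%:R + q%:R + 1 + nu) /
   ((2 * nu + p%:R + q%:R) * (p%:R + 1) * (p%:R + q%:R + nu) *
    (- N%:R - nu + k%:R - 1))).
Proof.
move=> k0; move: den_neq0; rewrite /walphaf.
have [k' kE] : exists k', k = k'.+1 by exists k.-1; lia.
have kN : (k' < N)%N by lia.
rewrite kE /=.
have -> : (p.+1 + k' = p + k'.+1)%N by lia.
have -> : (q + k'.+1 = (q + k').+1)%N by lia.
have -> : (u + p.+1 = (u + p).+1)%N by lia.
have -> : (p.+1 + q = (p + q).+1)%N by lia.
have -> : ((p + q).+1 + k' = (p + q + k').+1)%N by lia.
have -> : (p + q + k'.+1 = (p + q + k').+1)%N by lia.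
generalize_fact (p + k'.+1)%N; generalize_fact (u + q)%N.
rewrite !pochhammerS !natr_factS exprS.
generalize_fact (q + k')%N; generalize_fact (u + p)%N.
generalize_fact (p + q)%N; generalize_fact k'; generalize_fact u;
generalize_fact p; generalize_fact q.
generalize_poch n2 (p + q)%N; generalize_poch nu_gt0 (p + q + k')%N.
generalize_poch_neg (leqW (ltnW kN)).
generalize_poch nu_gt0 p; generalize_poch nu_gt0 q; generalize_fact N.
rewrite -!natr1 !natrD -?natr1.
generalize_nat p; generalize_nat q; generalize_nat k'; generalize_nat u; generalize_nat N.
move=> d0.
field; nonzero.
Qed.

Lemma walphaf_shift_q : (0 < u)%N ->
  (u%:R + p%:R) * walphaf nu p q.+1 k u.-1 = walphaf nu p q k u *
  ((p%:R + q%:R + 1) * u%:R * (nu + q%:R) * (q%:R + k%:R + 1) *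
   (p%:R + q%:R + 1 + nu) /
   ((2 * nu + p%:R + q%:R) * (q%:R + 1) * (p%:R + q%:R + nu) *
    (p%:R + q%:R + k%:R + 1 + nu))).
Proof.
move=> u0; rewrite /walphaf.
have [u' uE] : exists u', u = u'.+1 by exists u.-1; lia.
have kN : (k <= N)%N by lia.
rewrite uE /=.
have -> : (q.+1 + k = (q + k).+1)%N by lia.
have -> : (u' + q.+1 = u'.+1 + q)%N by lia.
have -> : (u'.+1 + p = (u' + p).+1)%N by lia.
have -> : (p + q.+1 = (p + q).+1)%N by lia.
have -> : ((p + q).+1 + k = (p + q + k).+1)%N by lia.
generalize_fact (p + k)%N; generalize_fact (u'.+1 + q)%N.
rewrite !pochhammerS !natr_factS.
generalize_fact (q + k)%N; generalize_fact (u' + p)%N.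
generalize_fact (p + q)%N; generalize_fact k; generalize_fact u';
generalize_fact p; generalize_fact q.
generalize_poch n2 (p + q)%N; generalize_poch nu_gt0 (p + q + k)%N.
generalize_poch_neg (leqW kN).
generalize_poch nu_gt0 p; generalize_poch nu_gt0 q; generalize_fact N.
rewrite -!natr1 !natrD -?natr1.
generalize_nat p; generalize_nat q; generalize_nat k; generalize_nat u'; generalize_nat N.
field; nonzero.
Qed.

Lemma walphaf_shift_nu :
  walphaf (nu + 1) p q k u = walphaf nu p q k u *
  (2 * nu * (2 * nu + 1) / ((2 * nu + p%:R + q%:R) * (2 * nu + p%:R + q%:R + 1)) *
   ((nu + p%:R) * (nu + q%:R) / (nu * (nu + p%:R + q%:R + k%:R))) *
   ((p%:R + q%:R + nu + 1) * (p%:R + q%:R + k%:R + nu) /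
    ((p%:R + q%:R + nu) * (p%:R + q%:R + k%:R + nu + 1))) *
   ((- N%:R - nu - 1) / (- N%:R - nu + k%:R - 1)) * ((N%:R + nu + 1) / (N%:R + nu))).
Proof.
have kN : (k <= N)%N by lia.
have d0 := den_neq0; move: den_neq0.
rewrite /walphaf.
have -> : pochhammer (2 * (nu + 1)) (p + q) = pochhammer (2 * nu) (p + q) *
    ((2 * nu + p%:R + q%:R) * (2 * nu + p%:R + q%:R + 1) / (2 * nu * (2 * nu + 1))).
  have -> : 2 * (nu + 1) = 2 * nu + 1 + 1 by ring.
  rewrite !poch_succ ?addr_gt0// natrD.
  move: (pochhammer _ _) => w; generalize_nat p; generalize_nat q.
  by field; nonzero.
rewrite !(poch_succ _ nu_gt0).
have -> : pochhammer (- N%:R - (nu + 1)) k = pochhammer (- N%:R - nu) k *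
    ((- N%:R - nu - 1) / (- N%:R - nu + k%:R - 1)).
  have -> : pochhammer (- N%:R - nu) k =
      pochhammer (- N%:R - nu - 1) k.+1 / (- N%:R - nu - 1).
    have e : - N%:R - nu - 1 != 0.
      by rewrite lt_eqF//; move: nu_gt0 (ler0n R N) => ? ?; lra.
    by rewrite pochhammerSl mulrAC divff// mul1r; congr pochhammer; ring.
  rewrite pochhammerS.
  have -> : - N%:R - (nu + 1) = - N%:R - nu - 1 by ring.
  have e : - N%:R - nu - 1 != 0.
    by rewrite lt_eqF//; move: nu_gt0 (ler0n R N) => ? ?; lra.
  by move: (pochhammer _ _) => w; field; rewrite ?e ?d0.
generalize_fact (p + k)%N; generalize_fact (q + k)%N.
generalize_fact (u + q)%N; generalize_fact (u + p)%N.
generalize_fact (p + q)%N; generalize_fact k; generalize_fact u;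
generalize_fact p; generalize_fact q.
generalize_poch n2 (p + q)%N; generalize_poch nu_gt0 (p + q + k)%N.
generalize_poch_neg (leqW kN).
generalize_poch nu_gt0 p; generalize_poch nu_gt0 q; generalize_fact N.
rewrite !natrD.
generalize_nat p; generalize_nat q; generalize_nat k; generalize_nat u; generalize_nat N.
move=> d1.
field; nonzero.
Qed.

End shifts.
End weight_coefficients.

(** * The Pearson equation of the matrix weight *)

Section weight_polynomials.
Variables (R : realType) (N : nat).
Implicit Types (nu : R) (i j k p q u : nat).

(** The weight entry stripped of (1 - x^2)^(nu - 1/2), which [moment] supplies. *)
Definition wpoly nu i j : {poly R} :=
  \sum_(i + j - N <= k < (minn i j).+1) alpha N nu k i j *: gegenbauer nu (i + j - k.*2).

(** With a range independent of i and j, sums for neighbouring entries combine termwise; the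
    coefficient at k = N + 1 is 0 and leaves room for a shift by one. *)
Lemma wpolyE nu i j : (i <= N)%N ->
  wpoly nu i j = \sum_(k < N.+2) walpha N nu i j k *: gegenbauer nu (i + j - k.*2).
Proof.
move=> iN; rewrite -(big_mkord xpredT
  (fun k => walpha N nu i j k *: gegenbauer nu (i + j - k.*2))).
have [h|h] := leqP (i + j - N) (minn i j).+1; last first.
  rewrite /wpoly [LHS]big_geq; last by lia.
  rewrite big1_seq// => k /andP[_]; rewrite mem_index_iota => kN.
  rewrite walpha_eq0 ?scale0r// => p q u e1 e2 e3; lia.
rewrite (@big_cat_nat _ _ _ (i + j - N)) /=; [|lia..].
rewrite [X in X + _]big1_seq ?add0r; last first.
  move=> k /andP[_]; rewrite mem_index_iota => kN.
  by rewrite walpha_eq0 ?scale0r// => p q u e1 e2 e3; lia.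
rewrite (@big_cat_nat _ _ _ (minn i j).+1) /=; [|lia..].
rewrite [X in _ + X]big1_seq ?addr0; last first.
  move=> k /andP[_]; rewrite mem_index_iota => kN.
  by rewrite walpha_eq0 ?scale0r// => p q u e1 e2 e3; lia.
apply: eq_big_nat => k kN; rewrite /walpha ifT//; lia.
Qed.

Lemma wpolyC nu i j : wpoly nu i j = wpoly nu j i.
Proof.
rewrite /wpoly addnC minnC; apply: eq_bigr => k _; congr (_ *: _).
rewrite /alpha [(j + i)%N]addnC [(j - k)`!%:R * (i - k)`!%:R]mulrC; ring.
Qed.

(** The constant can be read off from the entry (0, 0) of the Pearson equation, where both sides are
    multiples of x. *)
Definition pearson_cst nu : R :=
  - (2 * (2 * nu + 1) * (N%:R + nu + 1)) / (nu * (N%:R + nu) * (2 * nu + N%:R)).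

(** This compares coefficients of C_(i+j+1-2k): the left side comes from [gegenbauer_raise], the
    first bracket on the right from [gegenbauer_ttr]. Inside the support of alpha it is one rational
    identity. *)
Lemma walpha_pearson nu i j k : 0 < nu -> (i <= N)%N -> (j <= N)%N -> (k.*2 <= (i + j).+1)%N ->
  let m := i%:R + j%:R - 2 * k%:R in
  - ((m + 1) * (m + 2 * nu + 1) / (2 * nu)) * walpha N (nu + 1) i j k =
  pearson_cst nu *
  ((j%:R + nu) * (N%:R - j%:R + nu) *
     ((m + 1) / (2 * (m + nu)) * walpha N nu i j k +
      (m + 2 * nu + 1) / (2 * (m + 2 + nu)) * shift1 (walpha N nu i j) k) -
   j%:R / 2 * (N%:R - j%:R + nu) * shift1 (walpha N nu i j.-1) k -
   (N%:R - j%:R) / 2 * (j%:R + nu) * walpha N nu i j.+1 k).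
Proof.
move=> nu0 iN jN kij m.
have N0 : 0 <= N%:R :> R by [].
have pos0 := (ler0n R, nu0).
have [[p [q [u [iE jE NE]]]]|nex] := pselect (exists p q u : nat,
   [/\ i = (p + k)%N, j = (q + k)%N & N = (p + q + k + u)%N]).
  have k0 : 0 <= k%:R :> R by [].
  have p0 : 0 <= p%:R :> R by [].
  have q0 : 0 <= q%:R :> R by [].
  have u0 : 0 <= u%:R :> R by [].
  have NR : N%:R = p%:R + q%:R + k%:R + u%:R :> R by rewrite NE !natrD.
  have jR : j%:R = q%:R + k%:R :> R by rewrite jE natrD.
  have mE : m = p%:R + q%:R by rewrite /m iE jE !natrD; ring.
  set W := walphaf N nu p q k u.
  have T1 : walpha N nu i j k = W by rewrite (walphaE nu iE jE NE).
  have T2 := walphaE (nu + 1) iE jE NE; rewrite (walphaf_shift_nu nu0 NE) -/W in T2.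
  have T3 : shift1 (walpha N nu i j) k = - W *
    ((p%:R + q%:R + 1) * (p%:R + q%:R + 2) * k%:R * (nu + p%:R) * (nu + q%:R) *
   (p%:R + q%:R + 2 + nu) * u%:R /
   ((2 * nu + p%:R + q%:R) * (2 * nu + p%:R + q%:R + 1) *
    (p%:R + 1) * (q%:R + 1) *
    (p%:R + q%:R + k%:R + 1 + nu) * (p%:R + q%:R + nu) *
    (- N%:R - nu + k%:R - 1))).
    rewrite /shift1; case: ltnP => [k_gt0|k_le0]; last first.
      by have -> : k = 0%N by [lia|]; rewrite !(mulr0, mul0r).
    have [uz|u_gt0] := posnP u.
      rewrite walpha_eq0; first by rewrite uz !(mulr0, mul0r).
      by move=> p' q' u' e1 e2 e3; lia.
    by rewrite (@walphaE _ _ _ _ _ _ p.+1 q.+1 u.-1) ?(walphaf_shift_pq nu0 NE k_gt0 u_gt0)//; lia.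
  have T4 : j%:R * shift1 (walpha N nu i j.-1) k = - W *
   ((p%:R + q%:R + 1) * k%:R * (nu + p%:R) * (u%:R + p%:R + 1) *
   (p%:R + q%:R + 1 + nu) /
   ((2 * nu + p%:R + q%:R) * (p%:R + 1) * (p%:R + q%:R + nu) *
    (- N%:R - nu + k%:R - 1))).
    rewrite /shift1; case: ltnP => [k_gt0|k_le0]; last first.
      by have -> : k = 0%N by [lia|]; rewrite !(mulr0, mul0r).
    by rewrite jR (@walphaE _ _ _ _ _ _ p.+1 q u) ?(walphaf_shift_p nu0 NE k_gt0)//; lia.
  have T5 : (N%:R - j%:R) * walpha N nu i j.+1 k = W *
   ((p%:R + q%:R + 1) * u%:R * (nu + q%:R) * (q%:R + k%:R + 1) *
   (p%:R + q%:R + 1 + nu) /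
   ((2 * nu + p%:R + q%:R) * (q%:R + 1) * (p%:R + q%:R + nu) *
    (p%:R + q%:R + k%:R + 1 + nu))).
    have -> : N%:R - j%:R = u%:R + p%:R :> R by rewrite NR jR; ring.
    have [uz|u_gt0] := posnP u.
      rewrite walpha_eq0; first by rewrite uz !(mulr0, mul0r).
      by move=> p' q' u' e1 e2 e3; lia.
    by rewrite (@walphaE _ _ _ _ _ _ p q.+1 u.-1) ?(walphaf_shift_q nu0 NE u_gt0)//; lia.
  have -> : j%:R / 2 * (N%:R - j%:R + nu) * shift1 (walpha N nu i j.-1) k =
    (N%:R - j%:R + nu) / 2 * (j%:R * shift1 (walpha N nu i j.-1) k) by ring.
  have -> : (N%:R - j%:R) / 2 * (j%:R + nu) * walpha N nu i j.+1 k =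
    (j%:R + nu) / 2 * ((N%:R - j%:R) * walpha N nu i j.+1 k) by ring.
  rewrite T1 T2 T3 T4 T5 mE jR NR /pearson_cst.
  have d0 : - (p%:R + q%:R + k%:R + u%:R) - nu + k%:R - 1 != 0.
    by rewrite lt_eqF//; move: p0 q0 k0 u0 nu0 => *; lra.
  have d1 : 2 * nu + (p%:R + q%:R + k%:R + u%:R) != 0.
    by rewrite gt_eqF//; move: p0 q0 k0 u0 nu0 => *; lra.
  rewrite NR.
  move: d0 d1 p0 q0 k0 u0 {T1 T2 T3 T4 T5 NR jR mE m pos0 N0}.
  move: W (p%:R : R) (q%:R : R) (k%:R : R) (u%:R : R) => W P Q K U d0 d1 P0 Q0 K0 U0.
  have [a1 a2 a3 a4] : [/\ 2 * nu + P + Q != 0, 2 * nu + P + Q + 1 != 0, P + 1 != 0 & Q + 1 != 0].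
    by split; rewrite gt_eqF//; lra.
  have [b1 b2 b3 b4] : [/\ P + Q + K + 1 + nu != 0, P + Q + nu != 0, P + Q + 2 + nu != 0 & nu != 0].
    by split; rewrite gt_eqF//; lra.
  have [c1 c2 c3 c4] : [/\ P + Q + K + nu + 1 != 0, nu + P + Q + K != 0,
      P + Q + K + nu != 0 & P + Q + K + U + nu != 0].
    by split; rewrite gt_eqF//; lra.
  by field; repeat (apply/andP; split); assumption.
have z1 (b : R) : walpha N b i j k = 0.
  by apply: walpha_eq0 => p q u *; apply: nex; exists p, q, u.
rewrite !z1 !mulr0 add0r.
(* Here p would be -1: only the two terms taken at k - 1 survive, and they cancel. *)
have [ki|ki] := eqVneq k i.+1.
  have D0 : walpha N nu i j.+1 k = 0 by apply: walpha_eq0 => p q u *; lia.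
  have [q jE] : exists q, j = (q + k)%N by exists (j - k)%N; lia.
  have [u NE] : exists u, N = (0 + q + k.-1 + u.+1)%N by exists (N - q - k)%N; lia.
  have mE : m = q%:R - 1 by rewrite /m jE natrD ki -!natr1; ring.
  have s1 := walphaf_shift_q nu0 NE (ltn0Sn u); rewrite [u.+1.-1]/= in s1.
  have k_gt0 : (0 < k)%N by lia.
  rewrite D0 mulr0 subr0 /shift1 k_gt0.
  rewrite (@walphaE _ _ _ _ _ _ 0 q.+1 u); [|lia..].
  rewrite (@walphaE _ _ _ i j.-1 _ 0 q u.+1); [|lia..].
  have kE : k.-1%:R = k%:R - 1 :> R by rewrite ki -natr1; ring.
  have u0 : u.+1%:R != 0 :> R by rewrite pnatr_eq0.
  have -> : walphaf N nu 0 q.+1 k.-1 u = walphaf N nu 0 q k.-1 u.+1 *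
     ((q%:R + k%:R) * (q%:R + 1 + nu) / ((2 * nu + q%:R) * (q%:R + k%:R + nu))).
    apply: (mulfI u0); rewrite addr0 in s1; rewrite s1 kE.
    have [q0 k0] : 0 <= q%:R :> R /\ 0 <= k%:R :> R by split.
    move: (walphaf _ _ _ _ _ _) (q%:R : R) (k%:R : R) (u.+1%:R : R) q0 k0 u0 => W Q K U Q0 K0 U0.
    have [a1 a2 a3 a4] : [/\ 2 * nu + Q != 0, Q + K + nu != 0, Q + 1 != 0 & Q + nu != 0].
      by split; rewrite gt_eqF//; move: Q0 K0 nu0 => ? ? ?; lra.
    have a5 : Q + (K - 1) + 1 + nu != 0.
      by rewrite gt_eqF//; move: Q0 K0 nu0 => ? ? ?; lra.
    by field; rewrite ?(a1, a2, a3, a4, a5) ?add0r ?addr0 ?(a1, a2, a3, a4, a5).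
  rewrite mE jE natrD.
  have [q0 k0] : 0 <= q%:R :> R /\ 0 <= k%:R :> R by split.
  move: (walphaf _ _ _ _ _ _) (pearson_cst nu) => W kap.
  move: (q%:R : R) (k%:R : R) q0 k0 => Q K Q0 K0.
  have [a1 a2 a3] : [/\ 2 * nu + Q != 0, Q + K + nu != 0 & Q - 1 + 2 + nu != 0].
    by split; rewrite gt_eqF//; move: Q0 K0 nu0 => ? ? ?; lra.
  by field; rewrite ?(a1, a2, a3).
(* Here q would be -1: the terms at (j, k - 1) and (j + 1, k) survive and cancel. *)
have [kj|kj] := eqVneq k j.+1.
  have C0 : j%:R / 2 * (N%:R - j%:R + nu) * shift1 (walpha N nu i j.-1) k = 0.
    rewrite /shift1; case: ifP => [k0|_]; last by rewrite mulr0.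
    have [->|j0] := posnP j; first by rewrite !mul0r.
    by rewrite walpha_eq0 ?mulr0// => p q u *; lia.
  have [p iE] : exists p, i = (p + k)%N by exists (i - k)%N; lia.
  have [u NE] : exists u, N = (p + 0 + k + u)%N by exists (N - i)%N; lia.
  have mE : m = p%:R - 1 by rewrite /m iE natrD kj -!natr1; ring.
  have jR : j%:R = k%:R - 1 :> R by rewrite kj -natr1; ring.
  have NR : N%:R = p%:R + k%:R + u%:R :> R by rewrite NE addn0 !natrD.
  have k_gt0 : (0 < k)%N by lia.
  have s1 := walphaf_shift_p nu0 NE k_gt0.
  rewrite C0 subr0 /shift1 k_gt0.
  rewrite (@walphaE _ _ _ _ _ _ p.+1 0 u); [|lia..].
  rewrite (@walphaE _ _ _ i j.+1 _ p 0 u); [|lia..].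
  have k0 : k%:R != 0 :> R by rewrite pnatr_eq0 -lt0n.
  have -> : walphaf N nu p.+1 0 k.-1 u = walphaf N nu p 0 k u *
     ((u%:R + p%:R + 1) * (p%:R + 1 + nu) /
       ((2 * nu + p%:R) * (p%:R + u%:R + nu + 1))).
    apply: (mulfI k0); rewrite add0r in s1; rewrite s1 NR.
    have [p0 k1 u0] : [/\ 0 <= p%:R :> R, 0 <= k%:R :> R & 0 <= u%:R :> R] by split.
    move: (walphaf _ _ _ _ _ _) (p%:R : R) (k%:R : R) (u%:R : R) p0 k1 u0 {k0} => W P K U P0 K0 U0.
    have [a1 a2 a3 a4] : [/\ 2 * nu + P != 0, P + U + nu + 1 != 0, P + 1 != 0 & P + nu != 0].
      by split; rewrite gt_eqF//; move: P0 K0 U0 nu0 => ? ? ? ?; lra.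
    have a5 : - (P + K + U) - nu + K - 1 != 0.
      by rewrite lt_eqF//; move: P0 K0 U0 nu0 => ? ? ? ?; lra.
    by field; rewrite ?(a1, a2, a3, a4, a5) ?add0r ?addr0 ?(a1, a2, a3, a4, a5).
  rewrite mE jR NR.
  have [p0 k1 u0] : [/\ 0 <= p%:R :> R, 0 <= k%:R :> R & 0 <= u%:R :> R] by split.
  move: (walphaf _ _ _ _ _ _) (pearson_cst nu) => W kap.
  move: (p%:R : R) (k%:R : R) (u%:R : R) p0 k1 u0 {k0} => P K U P0 K0 U0.
  have [a1 a2 a3] : [/\ 2 * nu + P != 0, P + U + nu + 1 != 0 & P - 1 + 2 + nu != 0].
    by split; rewrite gt_eqF//; move: P0 K0 U0 nu0 => ? ? ? ?; lra.
  by field; rewrite ?(a1, a2, a3).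
have B0 : shift1 (walpha N nu i j) k = 0.
  rewrite /shift1; case: ifP => [k0|]; last by [].
  apply: walpha_eq0 => p q u *; apply: nex; exists p.-1, q.-1, u.+1; split; lia.
have C0 : j%:R / 2 * (N%:R - j%:R + nu) * shift1 (walpha N nu i j.-1) k = 0.
  rewrite /shift1; case: ifP => [k0|_]; last by rewrite mulr0.
  have [->|j0] := posnP j; first by rewrite !mul0r.
  rewrite walpha_eq0 ?mulr0// => p q u *; apply: nex; exists p.-1, q, u; split; lia.
have D0 : walpha N nu i j.+1 k = 0.
  apply: walpha_eq0 => p q u *; apply: nex; exists p, q.-1, u.+1; split; lia.
by rewrite B0 C0 D0 !mulr0 !subr0 mulr0.
Qed.

(** Multiplied by (1 - x^2)^(nu - 1/2), the left side is the derivative of the entry (i, j) of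
    W^(nu+1). The coefficients on the right involve only the column j, so Psi stands to the right of
    W. *)
Lemma wpoly_pearson nu i j : 0 < nu -> (i <= N)%N -> (j <= N)%N ->
  (1 - 'X^2) * (wpoly (nu + 1) i j)^`() - (2 * nu + 1) *: ('X * wpoly (nu + 1) i j) =
  pearson_cst nu *: (((j%:R + nu) * (N%:R - j%:R + nu)) *: ('X * wpoly nu i j) -
   (j%:R / 2 * (N%:R - j%:R + nu)) *: wpoly nu i j.-1 -
   ((N%:R - j%:R) / 2 * (j%:R + nu)) *: wpoly nu i j.+1).
Proof.
move=> nu0 iN jN; rewrite !wpolyE//.
pose C k := gegenbauer nu ((i + j).+1 - k.*2).
pose mr k := i%:R + j%:R - 2 * k%:R : R.
have mrE k : (k.*2 <= i + j)%N -> (i + j - k.*2)%:R = mr k.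
  by move=> kij; rewrite natrB// -mul2n natrM natrD.
have wz (b : R) k : (i + j < k.*2)%N -> walpha N b i j k = 0.
  by move=> ijk; apply: walpha_eq0 => p q u *; lia.
have lin (c d : R) (g : {poly R}) : (1 - 'X^2) * (c *: g)^`() - d *: ('X * (c *: g)) =
    c *: ((1 - 'X^2) * g^`() - d *: ('X * g)).
  by rewrite derivZ -!scalerAr scalerBr !scalerA [d * c]mulrC.
transitivity (\sum_(k < N.+2)
    (- ((mr k + 1) * (mr k + 2 * nu + 1) / (2 * nu)) * walpha N (nu + 1) i j k) *: C k).
  rewrite deriv_sum !mulr_sumr scaler_sumr -sumrB; apply: eq_bigr => k _.
  rewrite lin (gegenbauer_raise _ nu0) scalerA mulrC.
  have [kij|kij] := leqP k.*2 (i + j); last by rewrite wz// !mulr0 !scale0r.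
  by rewrite /C subSn// -natr1 mrE.
(* The [if] discards the k for which the truncated degree in [C k] is no longer i + j + 1 - 2k. *)
have -> : 'X * (\sum_(k < N.+2) walpha N nu i j k *: gegenbauer nu (i + j - k.*2)) =
    \sum_(k < N.+2) (if (k.*2 <= (i + j).+1)%N then
      (mr k + 1) / (2 * (mr k + nu)) * walpha N nu i j k +
      (mr k + 2 * nu + 1) / (2 * (mr k + 2 + nu)) * shift1 (walpha N nu i j) k
      else 0) *: C k.
  pose f k := walpha N nu i j k.
  transitivity (\sum_(k < N.+2) ((mr k + 1) / (2 * (mr k + nu)) * f k) *: C k +
     \sum_(k < N.+2) ((mr k + 2 * nu - 1) / (2 * (mr k + nu)) * f k) *:
       gegenbauer_pred nu (i + j - k.*2)).
    rewrite mulr_sumr -big_split; apply: eq_bigr => k _ /=; rewrite -scalerAr.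
    have [kij|kij] := leqP k.*2 (i + j); last by rewrite /f wz// !mulr0 !scale0r addr0.
    have mk0 : mr k + nu != 0 by rewrite -mrE// gt_eqF// ltr_wpDl.
    apply: (scalerI mk0); rewrite [LHS]scalerA [in LHS]mulrC -[LHS]scalerA -mrE//.
    rewrite (gegenbauer_ttr _ nu0) !(scalerA, scalerDr) -subSn// -natr1 mrE//.
    congr (_ *: _ + _ *: _).
      have -> : ((i + j).+1 - k.*2)%:R = mr k + 1 by rewrite subSn// -natr1 mrE.
      by rewrite /f; field.
    by rewrite /f; field.
  have -> : \sum_(k < N.+2) ((mr k + 2 * nu - 1) / (2 * (mr k + nu)) * f k) *:
       gegenbauer_pred nu (i + j - k.*2) =
     \sum_(k < N.+2) (if (k.*2 <= (i + j).+1)%N then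
       (mr k + 2 * nu + 1) / (2 * (mr k + 2 + nu)) * shift1 f k else 0) *: C k.
    rewrite [LHS]big_ord_recr [RHS]big_ord_recl /=.
    have -> : f N.+1 = 0 by apply: walpha_eq0 => p q u *; lia.
    rewrite !mulr0 !scale0r addr0 add0r; apply: eq_bigr => k _.
    rewrite /bump /= add1n /shift1 /= /C.
    have mS : mr k.+1 = mr k - 2 by rewrite /mr -natr1; ring.
    rewrite mS.
    case: ifP => [kij|kij].
      have -> : (i + j - k.*2 = ((i + j).+1 - k.+1.*2).+1)%N by lia.
      by congr ((_ / (2 * _) * _) *: _); ring.
    have -> : (i + j - k.*2 = 0)%N by lia.
    by rewrite scaler0 scale0r.
  rewrite -big_split; apply: eq_bigr => k _ /=; rewrite -scalerDl; congr (_ *: _).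
  by case: ifP => kij //; rewrite /f wz ?mulr0 ?addr0//; lia.
have -> : (j%:R / 2 * (N%:R - j%:R + nu)) *:
    \sum_(k < N.+2) walpha N nu i j.-1 k *: gegenbauer nu (i + j.-1 - k.*2) =
    \sum_(k < N.+2) (j%:R / 2 * (N%:R - j%:R + nu) * shift1 (walpha N nu i j.-1) k) *: C k.
  have [->|j0] := posnP j.
    by rewrite !mul0r scale0r big1// => k _; rewrite !mul0r scale0r.
  transitivity ((j%:R / 2 * (N%:R - j%:R + nu)) *:
      \sum_(k < N.+2) shift1 (walpha N nu i j.-1) k *: C k); last first.
    by rewrite scaler_sumr; apply: eq_bigr => k _; rewrite scalerA.
  congr (_ *: _).
  rewrite [LHS]big_ord_recr [RHS]big_ord_recl /=.
  rewrite walpha_eq0; last by move=> p q u *; lia.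
  rewrite !scale0r addr0 add0r; apply: eq_bigr => k _.
  rewrite /bump /= add1n /shift1 /= /C; congr (_ *: gegenbauer _ _); lia.
have -> : \sum_(k < N.+2) walpha N nu i j.+1 k *: gegenbauer nu (i + j.+1 - k.*2) =
    \sum_(k < N.+2) walpha N nu i j.+1 k *: C k.
  by apply: eq_bigr => k _; rewrite addnS.
rewrite !scaler_sumr -!sumrB scaler_sumr; apply: eq_bigr => k _.
rewrite !scalerA -!scalerBl scalerA; congr (_ *: _).
have [kij|kij] := leqP k.*2 (i + j).+1; first exact: walpha_pearson.
rewrite wz; last by lia.
have -> : j%:R / 2 * (N%:R - j%:R + nu) * shift1 (walpha N nu i j.-1) k = 0.
  rewrite /shift1; case: ifP => [k0|_]; last by rewrite mulr0.
  have [->|j0] := posnP j; first by rewrite !mul0r.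
  by rewrite walpha_eq0 ?mulr0// => p q u *; lia.
rewrite walpha_eq0; last by move=> p q u *; lia.
by rewrite !mulr0 !subr0 mulr0.
Qed.

End weight_polynomials.

Lemma pochhammer_opp (R : realType) (x : R) k :
  pochhammer (- x) k = (-1) ^+ k * pochhammer (x - k%:R + 1) k.
Proof.
elim: k => [|k IH]; first by rewrite !pochhammer0 mulr1.
rewrite pochhammerS IH pochhammerSl exprS.
have -> : x - k.+1%:R + 1 = x - k%:R by rewrite -natr1; ring.
by ring.
Qed.

(** C_(n+1) is a nonzero multiple of the raising operator applied to a polynomial, and
    [moment_pearson] annihilates such images. *)
Lemma moment_gegenbauer (R : realType) (nu : R) n : 0 < nu ->
  moment nu (gegenbauer nu n) = if n == 0%N then moment nu 1 else 0.
Proof.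
move=> nu0; case: n => [|n]; first by rewrite gegenbauer0.
have := moment_pearson (gegenbauer (nu + 1) n) nu0.
rewrite gegenbauer_raise// momentZ// => /eqP; rewrite mulf_eq0 => /orP[|/eqP->//].
rewrite oppr_eq0 gt_eqF// divr_gt0 ?mulr_gt0//.
by have := ler0n R n; move: nu0 => ? ?; lra.
Qed.

(** * Orthogonality of the expansion to lower powers of x *)

Section orthogonality.
Variables (R : realType) (N : nat).
Implicit Types (nu : R) (i j k l n p : nat) (f g : nat -> {poly R}).

(* Entry j of the row vector \int f W^(nu), for a row f of polynomials. *)
Definition pairing nu f j : R := \sum_(p < N.+1) moment nu (f p * wpoly N nu p j).

Lemma pairingD nu f g j : 0 < nu ->
  pairing nu (fun p => f p + g p) j = pairing nu f j + pairing nu g j.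
Proof.
by move=> nu0; rewrite -big_split; apply: eq_bigr => p _; rewrite mulrDl momentD.
Qed.

Lemma pairingZ nu (c : R) f j : 0 < nu ->
  pairing nu (fun p => c *: f p) j = c * pairing nu f j.
Proof.
by move=> nu0; rewrite mulr_sumr; apply: eq_bigr => p _; rewrite -scalerAl momentZ.
Qed.

Lemma pairing0 nu f j : 0 < nu -> (forall p, (p <= N)%N -> f p = 0) -> pairing nu f j = 0.
Proof.
by move=> nu0 f0; rewrite /pairing big1// => p _; rewrite f0 ?leq_ord// mul0r moment0.
Qed.

Lemma eq_pairing nu f g j : (forall p, (p <= N)%N -> f p = g p) ->
  pairing nu f j = pairing nu g j.
Proof. by move=> fg; apply: eq_bigr => p _; rewrite fg// leq_ord. Qed.

(** [moment_pearson] is applied to the product of [f p] with the weight entry at nu + 1, and summed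
    over p. At j = 0 and j = N, the column that does not exist carries the factor j or N - j, which
    is 0. *)
Lemma pairing_pearson nu f j : 0 < nu -> (j <= N)%N ->
  pearson_cst N nu * ((j%:R + nu) * (N%:R - j%:R + nu) * pairing nu (fun p => 'X * f p) j -
   j%:R / 2 * (N%:R - j%:R + nu) * pairing nu f j.-1 -
   (N%:R - j%:R) / 2 * (j%:R + nu) * pairing nu f j.+1) =
  - pairing (nu + 1) (fun p => (f p)^`()) j.
Proof.
move=> nu0 jN; rewrite !mulr_sumr -!sumrB mulr_sumr -sumrN; apply: eq_bigr => p _.
rewrite -!momentZ// -!momentB// -momentZ// moment_succ// -[RHS]mulN1r -momentZ// scaleN1r.
have [pN w] := (leq_ord p, wpoly_pearson nu0 (leq_ord p) jN).
set u := (X in moment nu X = _).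
have -> : u = f p * ((1 - 'X^2) * (wpoly N (nu + 1) p j)^`() -
    (2 * nu + 1) *: ('X * wpoly N (nu + 1) p j)).
  rewrite w /u -!scalerAr !mulrBr -!scalerAr; congr (_ *: (_ *: _ - _ - _)).
  by rewrite mulrCA mulrA.
apply/eqP; rewrite -subr_eq0 -momentB// opprK.
have <- := moment_pearson (f p * wpoly N (nu + 1) p j) nu0.
apply/eqP; congr moment; rewrite derivM mulrBr -scalerAr.
set a := wpoly _ _ _ _; rewrite -!mul_polyC; ring.
Qed.

(** For i = N the recurrence refers to row N + 1 with a coefficient that need not vanish. *)
Lemma expansion_out nu n p : expansion N nu n N.+1 p = 0.
Proof.
rewrite /expansion big1// => k _; rewrite /Fcoef gamma_coef_eq0 ?mulr0 ?scale0r//.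
by move=> r s t u *; lia.
Qed.

Lemma pairing_ttr nu l n i j : 0 < nu -> (i <= N)%N ->
  let a := nu + n%:R in
  let G l n i := pairing nu (fun p => 'X^l * expansion N nu n i p) j in
  (a + i%:R) * (a + N%:R - i%:R) * G l.+1 n i =
  a * (a + N%:R) * G l n.+1 i +
  (N%:R - i%:R + 1) * (i%:R + nu - 1) / 2 * shift1 (G l n) i +
  (i%:R + 1) * (N%:R - i%:R + nu - 1) / 2 * G l n i.+1 +
  n%:R * (N%:R + a) * (N%:R + n%:R + 2 * nu - 1) / (4 * (a + N%:R - 1)) * G l n.-1 i.
Proof.
move=> nu0 iN a G.
have -> : shift1 (G l n) i =
    pairing nu (fun p => 'X^l * shift1 (fun i => expansion N nu n i p) i) j.
  rewrite /shift1; case: ifP => // _.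
  by rewrite pairing0// => p _; rewrite mulr0.
rewrite /G -!pairingZ// -!pairingD//; apply: eq_pairing => p pN.
rewrite exprSr -mulrA [LHS]scalerAr expansion_ttr// !mulrDr.
by rewrite -!scalerAr.
Qed.

(** The diagonal entry at i of the integral of D_0 W. *)
Definition mass nu i : R :=
  nu * (N%:R + nu) ^+ 2 / ((i%:R + nu) * (N%:R - i%:R + nu)) * moment nu 1.

(** Only C_0 has a nonzero moment, and i + j = 2k with k <= min(i, j) forces i = j = k. *)
Lemma moment_wpoly nu i j : 0 < nu -> (i <= N)%N ->
  moment nu (wpoly N nu i j) = if i == j then walpha N nu i i i * moment nu 1 else 0.
Proof.
move=> nu0 iN; rewrite wpolyE// moment_sum//.
have -> : \sum_(k < N.+2) moment nu (walpha N nu i j k *: gegenbauer nu (i + j - k.*2)) =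
    \sum_(k < N.+2)
      (if (i == j) && (nat_of_ord k == i) then walpha N nu i i i * moment nu 1 else 0).
  apply: eq_bigr => k _; rewrite momentZ// moment_gegenbauer//.
  have [w|nz] := eqVneq (walpha N nu i j k) 0.
    rewrite w mul0r; case: ifP => [/andP[/eqP ij /eqP ki]|//].
    by rewrite -ij ki in w; rewrite w mul0r.
  have kij : (k <= i)%N && (k <= j)%N.
    by move: nz; rewrite /walpha; case: ifP => [/and3P[-> ->]//|]; rewrite eqxx.
  have -> : (i + j - k.*2 == 0)%N = (i == j) && (nat_of_ord k == i).
    by apply/eqP/andP => [h|[/eqP h1 /eqP h2]]; [split; apply/eqP; lia | lia].
  case: ifP => [/andP[/eqP ij /eqP ki]|_]; last by rewrite mulr0.
  by rewrite -ij ki.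
have [ij|ij] := eqVneq i j; last by rewrite big1.
have iN2 : (i < N.+2)%N by lia.
rewrite (bigD1 (Ordinal iN2))//= eqxx big1 ?addr0// => k /eqP kne.
by case: eqP => // ki; case: kne; apply: val_inj.
Qed.

Lemma pairing_expansion0 nu i j : 0 < nu -> (i <= N)%N -> (j <= N)%N ->
  pairing nu (expansion N nu 0 i) j = if i == j then mass nu i else 0.
Proof.
move=> nu0 iN jN; have lam0 : 0 < nu + N%:R by rewrite ltr_wpDr.
have iN1 : (i < N.+1)%N by [].
rewrite /pairing (bigD1 (Ordinal iN1))//= big1 ?addr0; last first.
  move=> p /eqP pi; rewrite /expansion big_ord_recl big_ord0 Fcoef_lead ?leq_ord//.
  case: eqVneq => [ip|_]; last by rewrite scale0r addr0 mul0r moment0.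
  by case: pi; apply: val_inj.
rewrite /expansion big_ord_recl big_ord0 addr0 Fcoef_lead// eqxx subnn gegenbauer0//.
rewrite mulr_algl momentZ// moment_wpoly//; case: ifP => [_|]; last by rewrite mulr0.
have NE : N = (0 + 0 + i + (N - i))%N by lia.
rewrite (walphaE nu (esym (add0n i)) (esym (add0n i)) NE) /walphaf /mass.
rewrite !add0n !pochhammer0 !addr0 !add0r !addn0 fact0.
have -> : - N%:R - nu = - (N%:R + nu) by ring.
rewrite pochhammer_opp.
set x := N%:R + nu - i%:R.
have x0 : 0 < x.
  by rewrite /x; have : i%:R <= N%:R :> R; [rewrite ler_nat | move: nu0 => ? ?; lra].
have -> : nu + (N - i)%:R = x by rewrite natrB// /x; ring.
have E : x * pochhammer (x + 1) i = pochhammer x i * (N%:R + nu).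
  by rewrite -pochhammerSl pochhammerS /x; congr (_ * _); ring.
have -> : pochhammer (x + 1) i = pochhammer x i * (N%:R + nu) / x.
  by rewrite -E mulrAC divff ?mul1r// gt_eqF.
have C : 'C(N, i)%:R * (i`!%:R * (N - i)`!%:R) = N`!%:R :> R by rewrite -!natrM bin_fact.
have px := pochhammer_gt0 i x0; have pn := pochhammer_gt0 i nu0.
have f0 := natr_fact_neq0 R.
have c0 : 'C(N, i)%:R != 0 :> R by rewrite pnatr_eq0 -lt0n bin_gt0.
have s : (-1) ^+ i * (-1) ^+ i = 1 :> R by rewrite -expr2 sqrr_sign.
have -> : N%:R - i%:R + nu = x by rewrite /x; ring.
have in0 : 0 < i%:R + nu by rewrite ltr_wpDl.
rewrite -C expr0.
move: (x) (moment nu 1) (pochhammer x i) (pochhammer nu i) px pn x0 s {E} => y M w w' px pn y0.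
move: ((-1) ^+ i) => e s.
(* One sign stems from alpha, the other from reflecting the Pochhammer symbol of -N - nu. *)
transitivity (e * e * (nu * (N%:R + nu) ^+ 2 / ((i%:R + nu) * y)) * M); last by rewrite s mul1r.
by field; rewrite !f0 c0 !gt_eqF.
Qed.

(** [moment_pearson] at p = X gives the second moment as [moment nu 1] divided by 2 nu + 2. *)
Lemma moment_ratio nu : 0 < nu -> moment (nu + 1) 1 = (2 * nu + 1) / (2 * nu + 2) * moment nu 1.
Proof.
move=> nu0; have := moment_pearson 'X nu0; rewrite moment_succ// mulr1.
rewrite derivX mulr1 !momentB// momentZ// -expr2 => /eqP; rewrite subr_eq0 => /eqP h.
have n2 : 2 * nu + 2 != 0 by rewrite gt_eqF// addr_gt0// mulr_gt0.
apply: (mulfI n2); rewrite mulrBr [RHS]mulrA [_ * (_ / _)]mulrCA divff// mulr1.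
have -> : (2 * nu + 2) * moment nu 'X^2 = moment nu 1.
  have -> : (2 * nu + 2) * moment nu 'X^2 = (2 * nu + 1) * moment nu 'X^2 + moment nu 'X^2 by ring.
  by rewrite -h subrK.
by ring.
Qed.

Let S nu n i j := pairing nu (expansion N nu n i) j.

Let S_out nu n j : 0 < nu -> S nu n N.+1 j = 0.
Proof. by move=> nu0; apply: pairing0 => // p _; exact: expansion_out. Qed.

Lemma pearson_cst_neq0 nu : 0 < nu -> pearson_cst N nu != 0.
Proof.
move=> nu0; have N0 := ler0n R N.
by rewrite /pearson_cst mulf_neq0// ?oppr_eq0 ?invr_eq0 gt_eqF// ?mulr_gt0//;
  move: nu0 N0 => ? ?; lra.
Qed.

Lemma pairing_expansion_step nu n i j : 0 < nu -> (i <= N)%N -> (j <= N)%N ->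
  let a := nu + n%:R in
  a * (a + N%:R) * S nu n.+1 i j = (a + i%:R) * (a + N%:R - i%:R) *
   ((- (n%:R * S (nu + 1) n.-1 i j) / pearson_cst N nu +
     j%:R / 2 * (N%:R - j%:R + nu) * S nu n i j.-1 +
     (N%:R - j%:R) / 2 * (j%:R + nu) * S nu n i j.+1) /
    ((j%:R + nu) * (N%:R - j%:R + nu))) -
  (N%:R - i%:R + 1) * (i%:R + nu - 1) / 2 * shift1 (fun i => S nu n i j) i -
  (i%:R + 1) * (N%:R - i%:R + nu - 1) / 2 * S nu n i.+1 j -
  n%:R * (N%:R + a) * (N%:R + n%:R + 2 * nu - 1) / (4 * (a + N%:R - 1)) * S nu n.-1 i j.
Proof.
move=> nu0 iN jN a.
pose G l m i' := pairing nu (fun p => 'X^l * expansion N nu m i' p) j.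
have E0 m i' : G 0%N m i' = S nu m i' j.
  by apply: eq_pairing => p _; rewrite expr0 mul1r.
have T : (a + i%:R) * (a + N%:R - i%:R) * G 1%N n i =
  a * (a + N%:R) * G 0%N n.+1 i +
  (N%:R - i%:R + 1) * (i%:R + nu - 1) / 2 * shift1 (G 0%N n) i +
  (i%:R + 1) * (N%:R - i%:R + nu - 1) / 2 * G 0%N n i.+1 +
  n%:R * (N%:R + a) * (N%:R + n%:R + 2 * nu - 1) / (4 * (a + N%:R - 1)) * G 0%N n.-1 i.
  exact: pairing_ttr.
(* The Pearson equation is solved for the integral of X Q_n; the divisor (j + nu)(N - j + nu) is
   positive for j <= N. *)
have tE : G 1%N n i = (- (n%:R * S (nu + 1) n.-1 i j) / pearson_cst N nu +
     j%:R / 2 * (N%:R - j%:R + nu) * S nu n i j.-1 +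
     (N%:R - j%:R) / 2 * (j%:R + nu) * S nu n i j.+1) /
    ((j%:R + nu) * (N%:R - j%:R + nu)).
  have P := pairing_pearson (expansion N nu n i) nu0 jN; rewrite -/(G 1%N n i) in P.
  have -> : n%:R * S (nu + 1) n.-1 i j = pairing (nu + 1) (fun p => (expansion N nu n i p)^`()) j.
    have nu1 : 0 < nu + 1 by rewrite addr_gt0.
    rewrite /S -pairingZ//; apply: eq_pairing => p _; rewrite deriv_expansion//.
    by case: n {a G E0 T P} => //; rewrite !scale0r.
  rewrite -P.
  have k0 := pearson_cst_neq0 nu0.
  have j0 : j%:R + nu != 0 by rewrite gt_eqF// ltr_wpDl.
  have Nj0 : N%:R - j%:R + nu != 0.
    by rewrite gt_eqF// ltr_wpDl// subr_ge0 ler_nat.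
  rewrite -/(S nu n i j.-1) -/(S nu n i j.+1).
  move: (S nu n i j.-1) (S nu n i j.+1) (pearson_cst N nu) k0 => x y k k0.
  by move: (G 1%N n i) => t; field; rewrite ?(k0, j0, Nj0).
clearbody G; have Sh : shift1 (G 0%N n) i = shift1 (fun i => S nu n i j) i.
  by rewrite /shift1; case: ifP => // _; rewrite E0.
rewrite !E0 Sh tE in T; rewrite T.
ring.
Qed.

(* At n = 1 the off-diagonal terms of the Pearson equation cancel those of the
   recurrence, and at n = 2 the term coming from the derivative cancels the one in
   Q_(n-2); for larger n every term vanishes by induction. *)
Lemma pairing_expansion nu n i j : 0 < nu -> (i <= N)%N -> (j <= N)%N ->
  S nu n i j = if (n == 0%N) && (i == j) then mass nu i else 0.
Proof.
elim/ltn_ind: n nu i j => -[|[|n]] IH nu i j nu0 iN jN; first exact: pairing_expansion0.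
- have N0 := ler0n R N.
  have H0 i' j' : (i' <= N)%N -> (j' <= N)%N -> S nu 0 i' j' = if i' == j' then mass nu i' else 0.
    by move=> *; apply: pairing_expansion0.
  have c0 : (nu + 0%:R) * (nu + 0%:R + N%:R) != 0.
    by rewrite gt_eqF// addr0 mulr_gt0// ltr_wpDr.
  apply: (mulfI c0); rewrite mulr0 pairing_expansion_step//.
  rewrite ?(mul0r, oppr0, subr0, addr0, add0r).
  have pos m : (m <= N)%N -> m%:R + nu != 0 :> R /\ N%:R - m%:R + nu != 0 :> R.
    by move=> mN; rewrite !gt_eqF// ltr_wpDl// subr_ge0 ler_nat.
  have [i1 i2] := pos _ iN; have [j1 j2] := pos _ jN.
  have Xout : S nu 0 i.+1 j = if i.+1 == j then mass nu j else 0.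
    have [iN'|iN'] := ltnP i N; first by rewrite H0//; case: eqP => [->|].
    have -> : i = N by lia.
    by rewrite S_out//; case: eqP => // h; lia.
  have Xsh : shift1 (fun i => S nu 0 i j) i = if i == j.+1 then mass nu j else 0.
    rewrite /shift1; case: ifP => [i0|i0]; last by case: eqP => // h; lia.
    rewrite H0//; last by lia.
    by have -> : (i.-1 == j) = (i == j.+1) by [lia|]; case: eqP => [->|].
  have Xp : j%:R / 2 * (N%:R - j%:R + nu) * S nu 0 i j.-1 =
      j%:R / 2 * (N%:R - j%:R + nu) * (if i.+1 == j then mass nu i else 0).
    have [->|j0] := posnP j; first by rewrite !mul0r.
    rewrite H0//; last by lia.
    by have -> : (i == j.-1) = (i.+1 == j) by lia.
  have Xn : (N%:R - j%:R) / 2 * (j%:R + nu) * S nu 0 i j.+1 =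
      (N%:R - j%:R) / 2 * (j%:R + nu) * (if i == j.+1 then mass nu i else 0).
    have [jN'|jN'] := ltnP j N; first by rewrite H0.
    have -> : j = N by lia.
    by rewrite subrr !mul0r.
  rewrite Xout Xsh Xp Xn /mass.
  have [ij|ij] := eqVneq i.+1 j.
    have -> : (i == j.+1) = false by lia.
    have jR : j%:R = i%:R + 1 :> R by rewrite -ij natr1.
    move: j1 j2 i1 i2; rewrite jR.
    move: (moment nu 1) (i%:R : R) (N%:R : R) => M x y j1 j2 i1 i2.
    by field; rewrite ?(j1, j2, i1, i2).
  have [ij'|ij'] := eqVneq i j.+1; last by rewrite !mulr0 ?mul0r !addr0 ?mul0r ?mulr0 !subr0.
  have iR : i%:R = j%:R + 1 :> R by rewrite ij' natr1.
  move: j1 j2 i1 i2; rewrite iR.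
  move: (moment nu 1) (j%:R : R) (N%:R : R) => M x y j1 j2 i1 i2.
  by field; rewrite ?(j1, j2, i1, i2).
- have nu1 : 0 < nu + 1 by rewrite addr_gt0.
  have a0 : 0 < nu + n.+1%:R by rewrite ltr_wpDr.
  have c0 : (nu + n.+1%:R) * (nu + n.+1%:R + N%:R) != 0.
    by rewrite gt_eqF// mulr_gt0// ltr_wpDr.
  apply: (mulfI c0); rewrite mulr0 pairing_expansion_step//.
  have Z i' j' : (i' <= N)%N -> (j' <= N)%N -> S nu n.+1 i' j' = 0.
    by move=> iN' jN'; rewrite IH.
  have Xout : S nu n.+1 i.+1 j = 0.
    have [iN'|iN'] := ltnP i N; first by rewrite Z.
    by have -> : i = N by [lia|]; rewrite S_out.
  have Xsh : shift1 (fun i => S nu n.+1 i j) i = 0.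
    rewrite /shift1; case: ifP => _; last by [].
    exact: Z (leq_trans (leq_pred i) iN) jN.
  have Xp : S nu n.+1 i j.-1 = 0 by exact: Z iN (leq_trans (leq_pred j) jN).
  have Xn : (N%:R - j%:R) / 2 * (j%:R + nu) * S nu n.+1 i j.+1 = 0.
    have [jN'|jN'] := ltnP j N; first by rewrite Z ?mulr0.
    by have -> : j = N by [lia|]; rewrite subrr !mul0r.
  rewrite Xout Xsh Xp Xn !mulr0 !addr0 !subr0 [n.+1.-1]/=.
  rewrite !IH//; case: n {IH c0 Z Xout Xsh Xp Xn} a0 => [|n] a0 /=; last by ring.
  case: eqP => [<-|_]; last by ring.
  rewrite /mass moment_ratio// /pearson_cst.
  have [x0 y0] : 0 <= i%:R :> R /\ 0 <= N%:R - i%:R :> R by rewrite subr_ge0 ler_nat.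
  have nE : N%:R = (N%:R - i%:R) + i%:R :> R by ring.
  rewrite nE; move: (i%:R : R) (N%:R - i%:R) (moment nu 1) x0 y0 => x y M x0 y0.
  have -> : y + x - x = y by ring.
  have [a1 a2 a3 a4] : [/\ nu != 0, x + nu != 0, y + nu != 0 & y + x + nu != 0].
    by split; rewrite gt_eqF//; move: nu0 x0 y0 => ? ? ?; lra.
  have [b1 b2 b3 b4] : [/\ 2 * nu + 1 != 0, 2 * nu + 2 != 0,
      y + x + nu + 1 != 0 & 2 * nu + (y + x) != 0].
    by split; rewrite gt_eqF//; move: nu0 x0 y0 => ? ? ?; lra.
  have [d1 d2 d3] : [/\ x + (nu + 1) != 0, y + (nu + 1) != 0 & nu + 1 + (y + x) - 1 != 0].
    by split; rewrite gt_eqF//; move: nu0 x0 y0 => ? ? ?; lra.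
  field.
  by rewrite ?(a1, a2, a3, a4, b1, b2, b3, b4, d1, d2, d3).
Qed.

(** The diagonal of the integral of x^n Q_n W. Each step contributes the coefficient of Q_(n-1) in
    the recurrence divided by that of X Q_n. *)
Fixpoint sqnorm nu n i : R :=
  if n is n'.+1 then
    let a := nu + n%:R in
    n%:R * (N%:R + a) * (N%:R + n%:R + 2 * nu - 1) / (4 * (a + N%:R - 1))
      / ((a + i%:R) * (a + N%:R - i%:R)) * sqnorm nu n' i
  else mass nu i.

Lemma sqnorm_gt0 nu n i : 0 < nu -> (i <= N)%N -> 0 < sqnorm nu n i.
Proof.
move=> nu0 iN; have N0 := ler0n R N; have i0 := ler0n R i.
have Ni : i%:R <= N%:R :> R by rewrite ler_nat.
elim: n => [|n IH] /=.
  rewrite /mass mulr_gt0 ?moment_gt0// divr_gt0 ?mulr_gt0 ?exprn_gt0//;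
  by move: nu0 N0 i0 Ni => *; lra.
have n0 := ler0n R n; rewrite -natr1.
move: IH; move: (sqnorm nu n i) => h h0; move: nu0 N0 i0 Ni n0 h0.
move: (i%:R : R) (n%:R : R) (N%:R : R) => x y z nu0 z0 x0 xz y0 h0.
by apply: mulr_gt0 => //; do !(apply: divr_gt0 || apply: mulr_gt0); lra.
Qed.

(** Induction on l for all n and i: in the recurrence for x^(l+1) Q_(n+1), the terms with Q_(n+2)
    and Q_(n+1) are paired with x^l, too low a power for them, so only x^l Q_n contributes. *)
Lemma pairing_exprX nu l n i j : 0 < nu -> (l <= n)%N -> (i <= N)%N -> (j <= N)%N ->
  pairing nu (fun p => 'X^l * expansion N nu n i p) j =
    if (l == n) && (i == j) then sqnorm nu n i else 0.
Proof.
move=> nu0; pose G l n i := pairing nu (fun p => 'X^l * expansion N nu n i p) j.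
rewrite -/(G l n i); elim: l n i => [|l IH] n i ln iN jN.
  have -> : G 0%N n i = S nu n i j by apply: eq_pairing => p _; rewrite expr0 mul1r.
  by rewrite pairing_expansion// eq_sym; case: n ln => [|n].
case: n ln => [//|n ln]; have {ln} ln : (l < n.+1)%N by [].
have T : let a := nu + n.+1%:R in (a + i%:R) * (a + N%:R - i%:R) * G l.+1 n.+1 i =
  a * (a + N%:R) * G l n.+2 i +
  (N%:R - i%:R + 1) * (i%:R + nu - 1) / 2 * shift1 (G l n.+1) i +
  (i%:R + 1) * (N%:R - i%:R + nu - 1) / 2 * G l n.+1 i.+1 +
  n.+1%:R * (N%:R + a) * (N%:R + n.+1%:R + 2 * nu - 1) / (4 * (a + N%:R - 1)) * G l n i.
  exact: (pairing_ttr l n.+1 j nu0 iN).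
have Gout m : G l m N.+1 = 0.
  by apply: pairing0 => // p _; rewrite expansion_out mulr0.
clearbody G; cbv zeta in T.
have Z m i' : (l < m)%N -> (i' <= N)%N -> G l m i' = 0.
  by move=> lm iN'; rewrite IH ?(ltnW lm)// ltn_eqF.
have X1 : shift1 (G l n.+1) i = 0.
  rewrite /shift1; case: ifP => _; last by [].
  exact: Z ln (leq_trans (leq_pred i) iN).
have X2 : G l n.+1 i.+1 = 0.
  move: iN; rewrite leq_eqVlt => /orP[/eqP->|iN]; first exact: Gout.
  exact: Z ln iN.
rewrite X1 X2 (Z n.+2 i (ltnW ln) iN) !mulr0 !add0r in T.
rewrite IH// in T.
have i0 := ler0n R i.
have Ni : i%:R <= N%:R :> R by rewrite ler_nat.
have a0 : 0 < nu + n.+1%:R by rewrite ltr_wpDr.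
have [d1 d2] : nu + n.+1%:R + i%:R != 0 /\ nu + n.+1%:R + N%:R - i%:R != 0.
  by split; rewrite gt_eqF//; move: a0 i0 Ni => *; lra.
apply: (mulfI (mulf_neq0 d1 d2)); rewrite T eqSS.
case: ifP => _; last by rewrite !mulr0.
rewrite /= [RHS]mulrA; congr (_ * _).
by rewrite [RHS]mulrC divfK// mulf_neq0.
Qed.

End orthogonality.

#[local] Opaque Gamma gamma_coef alpha gegenbauer.

(** * Degree and leading coefficient of the expansion *)

Section leading_coefficient.
Variables (R : realType) (N : nat).
Implicit Types (nu : R) (i j k l n p : nat).

Lemma coef_gegenbauer_gt lam n e : 0 < lam :> R -> (n < e)%N -> (gegenbauer lam n)`_e = 0.
Proof. by move=> lam0 ne; apply: gegenbauer_coef0 => // k nek; lia. Qed.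

Lemma coef_expansion_gt nu n i j e : 0 < nu -> (n < e)%N -> (expansion N nu n i j)`_e = 0.
Proof.
move=> nu0 ne; rewrite coef_sum big1// => k _.
rewrite coefZ coef_gegenbauer_gt ?mulr0//; first by rewrite ltr_wpDr.
by rewrite (leq_ltn_trans (leq_subr _ _) ne).
Qed.

Lemma coef_expansion_lead nu n (i j : 'I_N.+1) : 0 < nu ->
  (expansion N nu n i j)`_n = Dmx N nu n i j.
Proof.
move=> nu0; have lam0 : 0 < nu + N%:R by rewrite ltr_wpDr.
rewrite coef_sum big_ord_recl subn0 big1 ?addr0; last first.
  move=> k _; rewrite coefZ coef_gegenbauer_gt ?mulr0// lift0.
  by have := ltn_ord k; lia.
rewrite coefZ Fcoef_lead ?leq_ord//; have := gegenbauer_coefE n 0 lam0.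
rewrite double0 addn0 => ->.
rewrite /gegenbauer_coef !mxE -val_eqE /=.
case: (val i == val j); last by rewrite mul0r mulr0n.
rewrite fact0 !mulr1n addn0 expr0 !mul1r.
have p0 := pochhammer_gt0 n lam0.
have e0 : 2 ^+ n != 0 :> R by rewrite expf_neq0.
have f0 := natr_fact_neq0 R n.
move: (pochhammer _ n) p0 ('C(N, i)%:R * _) => x x0 y.
by field; rewrite f0 e0 gt_eqF.
Qed.

End leading_coefficient.

(** * The complex matrix pairing and the comparison with P_n *)

Section matrix_pairing.
Variables (R : realType) (N : nat).
Local Notation C := R[i].
Local Notation rc := (real_complex R).
Implicit Types (nu : R) (P Q : {poly 'M[C]_N.+1}).

Lemma Re_real_mul (c : C) (x : R) : complex.Re (c * rc x) = complex.Re c * x.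
Proof. by case: c => a b /=; rewrite mulr0 subr0. Qed.

Lemma Im_real_mul (c : C) (x : R) : complex.Im (c * rc x) = complex.Im c * x.
Proof. by case: c => a b /=; rewrite mulr0 add0r. Qed.

(** The integral is defined on real and imaginary parts separately; complex coefficients still
    factor out because the integrands they multiply are real. *)
Lemma Cintegral_moment nu (I : finType) (c : I -> C) (p : I -> {poly R}) : 0 < nu ->
  Cintegral `]-1, 1[ (fun x => \sum_t c t * rc ((1 - x ^+ 2) `^ (nu - 2^-1) * (p t).[x])) =
  \sum_t c t * rc (moment nu (p t)).
Proof.
move=> nu0; have RD : {morph @complex.Re R : x y / x + y} by move=> [? ?] [? ?].
have ID : {morph @complex.Im R : x y / x + y} by move=> [? ?] [? ?].
have RS (F : I -> C) : complex.Re (\sum_t F t) = \sum_t complex.Re (F t).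
  exact: (big_morph _ RD).
have IS (F : I -> C) : complex.Im (\sum_t F t) = \sum_t complex.Im (F t).
  exact: (big_morph _ ID).
have key (a : I -> R) : Rintegral (@lebesgue_measure R) `]-1, 1[
    (fun x => \sum_t a t * ((1 - x ^+ 2) `^ (nu - 2^-1) * (p t).[x])) =
    \sum_t a t * moment nu (p t).
  transitivity (moment nu (\sum_t a t *: p t)).
    apply: eq_Rintegral => x _; rewrite horner_sum mulr_sumr.
    by apply: eq_bigr => t _; rewrite hornerZ mulrCA.
  by rewrite moment_sum//; apply: eq_bigr => t _; rewrite momentZ.
have -> : \sum_t c t * rc (moment nu (p t)) =
    Complex (\sum_t complex.Re (c t) * moment nu (p t))
            (\sum_t complex.Im (c t) * moment nu (p t)).
  transitivity (Complex (complex.Re (\sum_t c t * rc (moment nu (p t))))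
                        (complex.Im (\sum_t c t * rc (moment nu (p t))))).
    by case: (\sum_t _).
  rewrite RS IS.
  by congr Complex; apply: eq_bigr => t _; rewrite ?Re_real_mul ?Im_real_mul.
by rewrite -!key; congr Complex; apply: eq_Rintegral => x _; rewrite ?RS ?IS;
  apply: eq_bigr => t _; rewrite ?Re_real_mul ?Im_real_mul.
Qed.

Lemma mxpoly_eval_coef P n (z : C) : (size P <= n)%N ->
  mxpoly_eval P z = \sum_(e < n) z ^+ e *: P`_e.
Proof.
move=> Pn; rewrite /mxpoly_eval (horner_coef_wide _ Pn); apply: eq_bigr => e _.
by rewrite -rmorphXn /= -mulmxE -scalemx1 -scalemxAr mulmx1.
Qed.

Lemma conj_real_complex (x : R) : (rc x)^* = rc x.
Proof. exact: conjc_real. Qed.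

Lemma adjmx_sum m (F : 'I_m -> 'M[C]_N.+1) : adjmx (\sum_f F f) = \sum_f adjmx (F f).
Proof.
apply/matrixP => i j; rewrite !(mxE, summxE) rmorph_sum /=.
by apply: eq_bigr => f _; rewrite !mxE.
Qed.

Lemma adjmxZ_real (x : R) (A : 'M[C]_N.+1) : adjmx (rc x *: A) = rc x *: adjmx A.
Proof.
apply/matrixP => i j; rewrite !mxE rmorphM /=; congr (_ * _).
exact: conj_real_complex.
Qed.

Lemma adjmxM (A B : 'M[C]_N.+1) : adjmx (A *m B) = adjmx B *m adjmx A.
Proof. by rewrite /adjmx map_mxM trmx_mul. Qed.

Lemma adjmx_real (A : 'M[R]_N.+1) : adjmx (map_mx rc A) = (map_mx rc A)^T.
Proof.
by apply/matrixP => i j; rewrite !mxE; exact: conj_real_complex.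
Qed.

Lemma mulmx_adjE (A B : 'M[C]_N.+1) (M : 'M[R]_N.+1) i j :
  (A *m map_mx rc M *m adjmx B) i j =
  \sum_(s : 'I_N.+1 * 'I_N.+1) A i s.2 * (B j s.1)^* * rc (M s.2 s.1).
Proof.
rewrite mxE -(pair_bigA _ (fun q p => A i p * (B j q)^* * rc (M p q))) /=.
apply: eq_bigr => q _; rewrite !mxE mulr_suml; apply: eq_bigr => p _.
by rewrite mxE mulrAC.
Qed.

Definition weight_moment nu m : 'M[R]_N.+1 :=
  \matrix_(p, q) moment nu ('X^m * wpoly N nu p q).

(** Reduces the complex integral to the real matrices [weight_moment]; the comparison of P_n with
    Q_n is then matrix algebra on coefficients. *)
Lemma gegenbauer_pairingE nu P Q n m : 0 < nu -> (size P <= n)%N -> (size Q <= m)%N ->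
  gegenbauer_pairing nu P Q = \sum_(e < n) \sum_(f < m)
    P`_e *m map_mx rc (weight_moment nu (e + f)) *m adjmx Q`_f.
Proof.
move=> nu0 Pn Qm; apply/matrixP => i j; rewrite mxE.
pose c (t : ('I_n * 'I_m) * ('I_N.+1 * 'I_N.+1)) : C :=
  P`_t.1.1 i t.2.2 * (Q`_t.1.2 j t.2.1)^*.
pose w (t : ('I_n * 'I_m) * ('I_N.+1 * 'I_N.+1)) : {poly R} :=
  'X^(t.1.1 + t.1.2) * wpoly N nu t.2.2 t.2.1.
have sumE (F : 'I_n -> 'I_m -> 'I_N.+1 * 'I_N.+1 -> C) :
    \sum_e \sum_f \sum_s F e f s = \sum_t F t.1.1 t.1.2 t.2.
  by rewrite pair_bigA pair_bigA.
transitivity (\sum_t c t * rc (moment nu (w t))); last first.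
  rewrite summxE; rewrite -(sumE (fun e f s => P`_e i s.2 * (Q`_f j s.1)^* *
    rc (moment nu ('X^(e + f) * wpoly N nu s.2 s.1)))).
  apply: eq_bigr => e _; rewrite summxE; apply: eq_bigr => f _.
  by rewrite mulmx_adjE; apply: eq_bigr => s _; rewrite mxE.
rewrite -Cintegral_moment//; congr Cintegral; apply/funext => x.
rewrite (mxpoly_eval_coef _ Pn) (mxpoly_eval_coef _ Qm) adjmx_sum !mulmx_suml summxE.
rewrite -(sumE (fun e f s => P`_e i s.2 * (Q`_f j s.1)^* *
  rc ((1 - x ^+ 2) `^ (nu - 2^-1) * ('X^(e + f) * wpoly N nu s.2 s.1).[x]))).
apply: eq_bigr => e _; rewrite mulmx_sumr summxE; apply: eq_bigr => f _.
rewrite -!rmorphXn /= adjmxZ_real -scalemxAr -!scalemxAl scalerA mxE mulmx_adjE mulr_sumr.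
apply: eq_bigr => s _; rewrite !mxE hornerM hornerXn exprD !rmorphM /=.
have -> : (wpoly N nu s.2 s.1).[x] = \sum_(s.2 + s.1 - N <= k < (minn s.2 s.1).+1)
    alpha N nu k s.2 s.1 * (gegenbauer nu (s.2 + s.1 - k.*2)).[x].
  by rewrite /wpoly horner_sum; apply: eq_bigr => k _; rewrite hornerZ.
by ring.
Qed.

Definition expansion_mx nu n e : 'M[R]_N.+1 := \matrix_(i, j) (expansion N nu n i j)`_e.

Lemma expansion_mx_gt nu n e : 0 < nu -> (n < e)%N -> expansion_mx nu n e = 0.
Proof. by move=> nu0 ne; apply/matrixP => i j; rewrite !mxE coef_expansion_gt. Qed.

Lemma expansion_mx_lead nu n : 0 < nu -> expansion_mx nu n n = Dmx N nu n.
Proof. by move=> nu0; apply/matrixP => i j; rewrite mxE coef_expansion_lead. Qed.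

Lemma expansion_mx_moment nu n l : 0 < nu -> (l <= n)%N ->
  \sum_(e < n.+1) expansion_mx nu n e *m weight_moment nu (e + l) =
  if l == n then diag_mx (\row_i sqnorm N nu n i) else 0.
Proof.
move=> nu0 ln; apply/matrixP => i j.
transitivity (pairing N nu (fun p => 'X^l * expansion N nu n i p) j); last first.
  rewrite pairing_exprX ?leq_ord//; case: (l == n); rewrite !mxE//=.
  by rewrite -val_eqE /=; case: eqP.
rewrite summxE /pairing.
under eq_bigr do rewrite mxE.
rewrite exchange_big; apply: eq_bigr => p _ /=.
have size_n : (size (expansion N nu n i p) <= n.+1)%N.
  by apply/leq_sizeP => e ne; rewrite coef_expansion_gt.
rewrite -[in RHS](coefK (expansion N nu n i p)) poly_def.
rewrite (_ : \sum_(e < _) _ = \sum_(e < n.+1) (expansion N nu n i p)`_e *: 'X^e); last first.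
  rewrite (big_ord_widen n.+1 (fun e => (expansion N nu n i p)`_e *: 'X^e)) //.
  rewrite big_mkcond; apply: eq_bigr => e _; case: ltnP => // le.
  by rewrite nth_default ?scale0r.
rewrite [X in moment nu (X * _)]mulr_sumr mulr_suml moment_sum//; apply: eq_bigr => e _.
by rewrite -scalerAr -scalerAl momentZ// -exprD addnC !mxE.
Qed.

Lemma weight_momentT nu m : (weight_moment nu m)^T = weight_moment nu m.
Proof. by apply/matrixP => i j; rewrite !mxE wpolyC. Qed.

Lemma monic_mx_gegenbauer_coef nu (P : nat -> {poly 'M[C]_N.+1}) : 0 < nu ->
  monic_mx_gegenbauer nu P -> forall n e,
  map_mx rc (Dmx N nu n) *m (P n)`_e = map_mx rc (expansion_mx nu n e).
Proof.
move=> nu0 [Pmonic Portho]; elim/ltn_ind => n IH.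
(* [K m e] is the integral of x^e Q_m W, zero below e = m and diagonal there. As W is symmetric,
   [TK] below says that D_n P_n - Q_n, with coefficients [T e], is orthogonal to Q_m. *)
pose K m e := \sum_(f < m.+1) expansion_mx nu m f *m weight_moment nu (e + f).
have KE m e : (e <= m)%N -> K m e = if e == m then diag_mx (\row_i sqnorm N nu m i) else 0.
  by move=> em; rewrite -expansion_mx_moment//; apply: eq_bigr => f _; rewrite addnC.
pose T e := map_mx rc (Dmx N nu n) *m (P n)`_e - map_mx rc (expansion_mx nu n e).
have TK m : (m < n)%N -> \sum_(e < n.+1) T e *m map_mx rc (K m e)^T = 0.
  move=> mn; rewrite /T.
  under eq_bigr do rewrite mulmxBl.
  rewrite sumrB (_ : \sum_(e < n.+1) map_mx rc (expansion_mx nu n e) *m _ = 0) ?subr0; last first.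
    (* Summing over e first exhibits the integrals of x^f Q_n W with f <= m < n, all of which
       vanish. *)
    transitivity (map_mx rc (\sum_(f < m.+1) (\sum_(e < n.+1)
        expansion_mx nu n e *m weight_moment nu (e + f)) *m (expansion_mx nu m f)^T)).
      under [in RHS]eq_bigr do rewrite mulmx_suml.
      rewrite exchange_big raddf_sum /=; apply: eq_bigr => e _.
      rewrite -map_mxM raddf_sum mulmx_sumr; congr map_mx; apply: eq_bigr => f _.
      by rewrite /= trmx_mul weight_momentT mulmxA.
    rewrite big1 ?map_mx0// => f _.
    have fn : (f < n)%N by rewrite (leq_trans (ltn_ord f)).
    by rewrite expansion_mx_moment ?ltn_eqF ?mul0mx// ltnW.
  have PP := Portho n m; rewrite (@gegenbauer_pairingE nu _ _ n.+1 m.+1) in PP;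
    [|by []|by case: (Pmonic n) => _ ->|by case: (Pmonic m) => _ ->].
  transitivity (map_mx rc (Dmx N nu n) *m (\sum_(e < n.+1) \sum_(f < m.+1)
     (P n)`_e *m map_mx rc (weight_moment nu (e + f)) *m adjmx (P m)`_f) *m
      adjmx (map_mx rc (Dmx N nu m))); last first.
    by rewrite PP ?mulmx0 ?mul0mx// => nm; rewrite nm ltnn in mn.
  rewrite mulmx_sumr mulmx_suml; apply: eq_bigr => e _.
  rewrite mulmx_sumr mulmx_suml raddf_sum raddf_sum mulmx_sumr; apply: eq_bigr => f _.
  rewrite /= -!mulmxA; congr (_ *m (_ *m _)).
  (* By induction D_m P_m has the real coefficients of Q_m, so its adjoint is a transpose. *)
  by rewrite -adjmxM IH// adjmx_real trmx_mul weight_momentT map_mxM map_trmx.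
suff Tn : forall t e, (n - t <= e)%N -> T e = 0.
  by move=> e; apply/eqP; rewrite -subr_eq0; apply/eqP; apply: (Tn n); rewrite subnn.
elim=> [|t IHt] e.
  rewrite subn0 leq_eqVlt => /orP[/eqP <-|ne].
    rewrite /T expansion_mx_lead//; have [Pm sP] := Pmonic n.
    have -> : (P n)`_n = 1%:M by move/monicP: Pm; rewrite lead_coefE sP.
    by rewrite mulmx1 subrr.
  by rewrite /T expansion_mx_gt// nth_default ?(proj2 (Pmonic n))// map_mx0 mulmx0 subrr.
have [/IHt//|en] := leqP (n - t) e.
move=> te; have en' : (e < n)%N by apply: leq_trans en (leq_subr _ _).
have eN : (e < n.+1)%N by apply: ltnW.
(* The system is triangular: against Q_e, degrees below e drop out by orthogonality and degrees
   above e by induction, leaving [T e] times an invertible diagonal matrix. *)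
have := TK e en'; rewrite (bigD1 (Ordinal eN))//= big1 ?addr0; last first.
  move=> f /eqP fe; have [fe'|ef] := ltnP f e.
    by rewrite KE ?ltn_eqF ?trmx0 ?map_mx0 ?mulmx0// ltnW.
  rewrite IHt ?mul0mx//.
  have ne : nat_of_ord f <> e by move=> h; apply: fe; apply: val_inj.
  by move: ne ef te; lia.
rewrite KE// eqxx tr_diag_mx => h; apply/matrixP => i j.
have := congr1 (fun M : 'M[C]_N.+1 => M i j) h.
rewrite map_diag_mx mul_mx_diag !mxE => /eqP; rewrite mulf_eq0 => /orP[/eqP//|].
by rewrite fmorph_eq0 gt_eqF// sqnorm_gt0// leq_ord.
Qed.

End matrix_pairing.

Theorem theorem3p6 (R : realType) (N : nat) (nu : R) (nu_gt0 : 0 < nu)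
    (P : nat -> {poly 'M[R[i]]_N.+1})
    (P_mvop : monic_mx_gegenbauer nu P) (n : nat) (z : R[i]) :
  hat_mx_gegenbauer nu P n z =
  \sum_(k < (minn n N).+1)
    (map_poly (real_complex R) (gegenbauer (nu + N%:R) (n - k))).[z]
      *: map_mx (real_complex R) (Fmx N nu k n).
Proof.
have sP : (size (P n) <= n.+1)%N by case: P_mvop => /(_ n) [_ ->].
rewrite /hat_mx_gegenbauer (mxpoly_eval_coef _ sP) mulmx_sumr; apply/matrixP => i j.
have size_n : (size (expansion N nu n i j) <= n.+1)%N.
  by apply/leq_sizeP => e ne; rewrite coef_expansion_gt.
transitivity (map_poly (real_complex R) (expansion N nu n i j)).[z].
  rewrite (horner_coef_wide _ (leq_trans (size_poly _ _) size_n)) summxE.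
  apply: eq_bigr => e _; rewrite -scalemxAr monic_mx_gegenbauer_coef//.
  by rewrite !mxE coef_map mulrC.
rewrite /expansion rmorph_sum horner_sum summxE /=.
rewrite (big_ord_widen n.+1 (fun k => ((map_poly (real_complex R)
  (gegenbauer (nu + N%:R) (n - k))).[z] *: map_mx (real_complex R) (Fmx N nu k n)) i j));
  last by rewrite ltnS geq_minl.
rewrite [RHS]big_mkcond; apply: eq_bigr => k _.
rewrite map_polyZ hornerZ ltnS leq_min -ltnS ltn_ord /=.
case: leqP => kN; first by rewrite !mxE mulrC.
rewrite /Fcoef gamma_coef_eq0 ?mulr0 ?rmorph0 ?mul0r//.
by move=> r s t u _ _ e1 e2; move: kN; rewrite e1 e2; lia.
Qed.
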